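(* Let $\Sigma:\mathbf{y}=\mathbf{G}(x,\mathbf{y})$ be a well-conditioned system with extreme point $(\rho,\boldsymbol{\tau})$. Then the following hold: (a) $(\rho,\boldsymbol{\tau})\in\mathsf{Dom}^{+}(\mathbf{G})$. (b) If $(\rho,\boldsymbol{\tau})$ is in the interior of $\mathsf{Dom}^{+}(\mathbf{G})$ then it is an eigenpoint of $\Sigma$. (c) The system $\Sigma$ has at most one eigenpoint. (d) If there is an eigenpoint of $\Sigma$ then it must be $(\rho,\boldsymbol{\tau})$. (e) If there is no eigenpoint of $\Sigma$ then $(\rho,\boldsymbol{\tau})$ lies on the boundary of $\mathsf{Dom}^{+}(\mathbf{G})$ and $\Lambda(\rho,\boldsymbol{\tau})<1$.
   Context: Let $m\ge 1$ and $\mathbf{y}=(y_1,\dots,y_m)$. A system $\mathbf{y}=\mathbf{G}(x,\mathbf{y})$ means $y_i=G_i(x,y_1,\dots,y_m)$, $1\le i\le m$, where the $G_i$ are power series; its Jacobian matrix is $J_{\mathbf{G}}(x,\mathbf{y})=\big(\partial G_i/\partial y_j\big)_{1\le i,j\le m}$ (no derivative in $x$). The system is well-conditioned if: (a) each $G_i(x,\mathbf{y})$ is a power series with nonnegative real coefficients; (b) $\mathbf{G}$ is holomorphic in a neighborhood of the origin; (c) $\mathbf{G}(0,\mathbf{y})=\mathbf{0}$; (d) $G_i(x,\mathbf{0})\ne 0$ for all $i$; (e) the system is irreducible, i.e. the nonnegative matrix of power series $J_{\mathbf{G}}$ is irreducible (the directed graph on $\{1,\dots,m\}$ with an edge $i\to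 j$ whenever $\partial G_i/\partial y_j\neq 0$ is strongly connected); (f) $\partial^2 G_i/\partial y_j\partial y_k\ne 0$ for some $i,j,k$. For a well-conditioned system there is a unique vector $\mathbf{T}(x)=(T_1(x),\dots,T_m(x))$ of formal power series with nonnegative coefficients such that $\mathbf{T}(x)=\mathbf{G}(x,\mathbf{T}(x))$ formally (it satisfies $\mathbf{T}(0)=\mathbf{0}$); it is called the standard solution. It is a standard fact that all $T_i$ have the same radius of convergence $\rho\in(0,\infty)$ and that $\tau_i:=T_i(\rho)<\infty$. With $\boldsymbol{\tau}=(\tau_1,\dots,\tau_m)$, the point $(\rho,\boldsymbol{\tau})$ is the extreme point of the system. The positive domain is $\mathsf{Dom}^{+}(\mathbf{G})=\{(a,\mathbf{b}): a,b_1,\dots,b_m>0,\ G_i(a,\mathbf{b})<\infty \text{ for } 1\le i\le m\}\subseteq\mathbb{R}^{m+1}$, where a nonnegative power series has value $\infty$ at a nonnegative point where it diverges. $\Lambda(a,\mathbf{b})$ denotes the largest real eigenvalue (equivalently the spectral radius) of the nonnegative matrix $J_{\mathbf{G}}(a,\mathbf{b})$. A characteristic point of the system is a point $(a,\mathbf{b})\in\mathbb{R}^{m+1}$ with all coordinates positive that solves the characteristic system $\mathbf{y}=\mathbf{G}(x,\mathbf{y})$, $\det\big(I-J_{\mathbf{G}}(x,\mathbf{y})\big)=0$ (in particular the series $G_i$ and $\partial G_i/\partial y_j$ converge at $(a,\mathbf{b})$). An eigenpoint is a characteristic point $(a,\mathbf{b})$ with $\Lambda(a,\mathbf{b})=1$.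 *)

(* Defs.v *)
From HB Require Import structures.
From mathcomp Require Export all_boot all_order all_algebra.
From mathcomp Require Export all_classical all_reals all_analysis.
From mathcomp Require Export complex.

Set Implicit Arguments.
Unset Strict Implicit.
Unset Printing Implicit Defensive.
Import Order.TTheory GRing.Theory Num.Theory.
Import numFieldTopology.Exports numFieldNormedType.Exports.
Local Open Scope classical_set_scope.
Local Open Scope ring_scope.

Local Notation normc := ComplexField.Normc.normc.

(* MathComp-Analysis, over an arbitrary R : realType. A power series in
   x, y_1, .., y_m is its coefficient function: g (k, al) is the coefficient of
   x^k y^al, and the index set {1, .., m} is 'I_m. *)
Definition pwser (R : realType) (m : nat) := nat * {ffun 'I_m -> nat} -> R.

Definition pwsys (R : realType) (m : nat) := 'I_m -> pwser R m.

(* R^(m+1), a point being (x, y). *)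
Definition point (R : realType) (m : nat) := (R * 'rV[R]_m)%type.

Section PowerSeries.
Variables (R : realType) (m : nat).
Implicit Types (g : pwser R m) (p : point R m).

Definition pderiv (j : 'I_m) g : pwser R m := fun q =>
  (q.2 j).+1%:R * g (q.1, [ffun i => (q.2 i + (i == j))%N]).

(* Used only for g with nonnegative coefficients and p with nonnegative
   coordinates, where it is the value in [0, +oo] of the series. *)
Definition pwval g p : \bar R :=
  \esum_(q in [set: nat * {ffun 'I_m -> nat}])
    (g q * (p.1 ^+ q.1 * \prod_(j < m) p.2 0 j ^+ q.2 j))%:E.

Definition abs_cvg_at g (z : R[i]) (w : 'I_m -> R[i]) : Prop :=
  (\esum_(q in [set: nat * {ffun 'I_m -> nat}])
    (normc ((g q)%:C%C * (z ^+ q.1 * \prod_(j < m) w j ^+ q.2 j)))%:E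
  < +oo)%E.

(* Coefficient of x^n in g(x, T_1(x), .., T_m(x)), for series T_j without
   constant term: then only exponents at most n contribute, and the T_j may be
   truncated after x^n. *)
Definition subst_coef g (T : 'I_m -> nat -> R) (n : nat) : R :=
  \sum_(k < n.+1) \sum_(al : {ffun 'I_m -> 'I_n.+1})
    g (k : nat, [ffun j => al j : nat])
    * ('X^k * \prod_(j < m) (\poly_(l < n.+1) T j l) ^+ al j)`_n.

End PowerSeries.

Section System.
Variables (R : realType) (m : nat).
Implicit Types (G : pwsys R m) (p : point R m).

(* A power series defines a holomorphic function near the origin of C^(m+1)
   when it converges absolutely on some open polydisc. *)
Definition holomorphic_at_origin G : Prop :=
  exists2 r : R, 0 < r &
    forall (z : R[i]) (w : 'I_m -> R[i]),
      normc z < r -> (forall j, normc (w j) < r) ->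
      forall i, abs_cvg_at (G i) z w.

(* Edge i -> j of the dependency digraph: dG_i/dy_j is not the zero series. *)
Definition dependency G : rel 'I_m :=
  fun i j => `[< exists q, pderiv j (G i) q <> 0 >].

Definition irreducible_system G : Prop :=
  forall i j, connect (dependency G) i j.

Record well_conditioned G : Prop := WellConditioned {
  wc_nneg : forall i q, 0 <= G i q;
  wc_holo : holomorphic_at_origin G;
  wc_x0 : forall i al, G i (0%N, al) = 0;
  wc_y0 : forall i, exists k, G i (k, [ffun=> 0%N]) <> 0;
  wc_irr : irreducible_system G;
  wc_nonlinear : exists i j k q, pderiv k (pderiv j (G i)) q <> 0 }.

Definition standard_solution G (T : 'I_m -> nat -> R) : Prop :=
  [/\ forall i n, 0 <= T i n,
      forall i, T i 0%N = 0 &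
      forall i n, T i n = subst_coef (G i) T n].

Definition convergence_radius (t : nat -> R) : \bar R :=
  ereal_sup [set r%:E | r in [set r : R | 0 <= r /\ cvgn (pseries t r)]].

Definition extreme_point G p : Prop :=
  exists2 T, standard_solution G T &
    forall i, convergence_radius (T i) = p.1%:E /\
              pseries (T i) p.1 @ \oo --> p.2 0 i.

Definition positive_point p : Prop := 0 < p.1 /\ forall i, 0 < p.2 0 i.

Definition pos_domain G : set (point R m) :=
  [set p | positive_point p /\ forall i, (pwval (G i) p < +oo)%E].

Definition jacobian_finite G p : Prop :=
  forall i j, (pwval (pderiv j (G i)) p < +oo)%E.

(* Meaningful only under jacobian_finite, since fine +oo = 0. *)
Definition jacobian G p : 'M[R]_m :=
  \matrix_(i, j) fine (pwval (pderiv j (G i)) p).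

Definition largest_eigenvalue (M : 'M[R]_m) (l : R) : Prop :=
  eigenvalue M l /\ forall l', eigenvalue M l' -> l' <= l.

Definition Lambda_is G p (l : R) : Prop :=
  jacobian_finite G p /\ largest_eigenvalue (jacobian G p) l.

Definition characteristic_point G p : Prop :=
  [/\ positive_point p,
      forall i, pwval (G i) p = (p.2 0 i)%:E,
      jacobian_finite G p &
      \det (1%:M - jacobian G p) = 0].

Definition eigenpoint G p : Prop :=
  characteristic_point G p /\ Lambda_is G p 1.

End System.

(* Main.v *)
(* Let S_n be the partial sums of the standard solution T. Since x divides G,
   S_(n+1)(x) <= G(x, S_n(x)), so any b >= 0 with G(x, b) <= b bounds T(x) and forces
   x <= rho. Tangent inequalities for power series with nonnegative coefficients,
   applied to the gaps v_n = tau - S_n(rho) > 0, give J(rho, S_n(rho)) v_n <= v_n; by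
   irreducibility this bounds J(rho, tau) entrywise, and Lambda(rho, tau) <= 1 follows by
   pairing with a left Perron vector.
   If Lambda(rho, tau) < 1 and w > 0 is a right Perron vector, then near an interior point
   G(rho + d, tau + s w) <= tau + s w for small d, s > 0, contradicting x <= rho.
   At an eigenpoint (a, b) one has a <= rho and T(a) <= b; pairing b - T(a) with the left
   fixed vector of J(a, b), nonlinearity forces T(a) = b, and then dependence on x forces
   a = rho. *)
Require Import Defs.
From mathcomp Require Import ring lra.
Set Implicit Arguments.
Unset Strict Implicit.
Unset Printing Implicit Defensive.
Import Order.TTheory GRing.Theory Num.Theory.
Import numFieldTopology.Exports numFieldNormedType.Exports.
Local Open Scope classical_set_scope.
Local Open Scope ring_scope.

(** * Perron-Frobenius theory *)

Section Perron.
Variables (R : realType) (m : nat).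
Implicit Types (e : rel 'I_m) (f u v z : 'I_m -> R) (M : 'M[R]_m).

(** The obstacle is that [(rho, tau)] may lie on the boundary of the domain, where the derivatives
    of [G] are not known in advance to be finite, so nothing can be expanded there. The partial sums
    at [rho] serve as base points instead: the tangent inequality towards [tau] has a finite right
    side, and positive gaps then force finite derivatives. This bounds the derivatives only by
    ratios of gaps; a Harnack constant independent of [n] is what lets the bound survive the limit.
    Every inequality on [G] is proved monomial by monomial. Along a line with nonnegative direction
    a monomial is a one-variable polynomial with nonnegative coefficients, and summation takes place
    in [0, +oo], so no convergence has to be known beforehand. Strictness is recorded as an additive
    gap, which remains usable until the sums are known to be finite. Both Perron vectors serve: the
    positive left one tests inequalities, the positive right one is a direction of displacement. *)

Lemma finite_lower_bound (I : finType) (P : pred I) (h : I -> R) :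
  (forall i, P i -> 0 < h i) -> exists2 d, 0 < d & forall i, P i -> d <= h i.
Proof.
move=> h0; exists (\big[Order.min/1]_(i | P i) h i).
  by elim/big_ind: _ => // x y x0 y0; rewrite lt_min x0.
by move=> i Pi; rewrite (bigD1 i) //= ge_min lexx.
Qed.

(** Each edge of a path costs a factor [d], and finitely many pairs of vertices give one constant.
    That [c] precedes [f] is essential: it is later applied to infinitely many vectors at once. *)
Lemma harnack e (d : R) : 0 < d -> (forall i j, connect e i j) ->
  exists2 c, 0 < c & forall f, (forall i, 0 <= f i) ->
    (forall i j, e i j -> d * f j <= f i) -> forall i j, c * f j <= f i.
Proof.
move=> d0 econ.
have H (ij : 'I_m * 'I_m) : exists c, 0 < c /\
    forall f, (forall i j, e i j -> d * f j <= f i) -> c * f ij.2 <= f ij.1.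
  case: ij => i j /=; have /connectP[p ep ->] := econ i j.
  elim: p i ep => [|k p IH] i /=.
    by move=> _; exists 1; split => // f _; rewrite mul1r.
  case/andP=> ik /IH[c [c0 cP]]; exists (d * c); split; first exact: mulr_gt0.
  move=> f fe; apply: le_trans (fe _ _ ik).
  by rewrite -mulrA ler_wpM2l ?(ltW d0) ?cP.
have /choice[c cP] := H.
have [b b0 bP] := @finite_lower_bound _ predT c (fun ij _ => (cP ij).1).
exists b => // f f0 fe i j; apply: le_trans ((cP (i, j)).2 _ fe).
by rewrite ler_wpM2r // bP.
Qed.

Definition positive_digraph M : rel 'I_m := fun i j => 0 < M i j.

Lemma positive_digraph_tr M :
  (forall i j, connect (positive_digraph M) i j) ->
  forall i j, connect (positive_digraph M^T) i j.
Proof.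
move=> Mc i j.
rewrite (@eq_connect _ _ [rel x y | positive_digraph M y x]) ?connect_rev.
  exact: Mc.
by move=> x y; rewrite /= /positive_digraph mxE.
Qed.

(** For a nonnegative matrix the infimum of this set is the Perron root, in its Collatz-Wielandt
    description. *)
Definition strict_super M : set R :=
  [set t | exists2 v, (forall i, 0 < v i) &
           forall i, \sum_j M i j * v j < t * v i].

Lemma strict_super_up M t t' : strict_super M t -> t <= t' -> strict_super M t'.
Proof.
move=> [v v0 vP] tt'; exists v => // i; apply: lt_le_trans (vP i) _.
by rewrite ler_pM2r.
Qed.

Lemma strict_super_open M t : strict_super M t ->
  exists2 t', t' < t & strict_super M t'.
Proof.
move=> [v v0 vP].
have [|d d0 dP] := @finite_lower_bound _ predT
    (fun i => t - (\sum_j M i j * v j) / v i).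
  by move=> i _; rewrite subr_gt0 ltr_pdivrMr.
exists (t - d / 2); first by rewrite ltrBlDr ltrDl divr_gt0.
exists v => // i; rewrite -ltr_pdivrMr //.
have := dP i isT; lra.
Qed.

Section Nonneg.
Variables (M : 'M[R]_m) (hm : (0 < m)%N) (M0 : forall i j, 0 <= M i j).

Lemma strict_super_pos t : strict_super M t -> 0 < t.
Proof.
move=> [v v0 vP]; pose i := Ordinal hm.
rewrite -(pmulr_lgt0 _ (v0 i)); apply: le_lt_trans (vP i).
by apply: sumr_ge0 => j _; rewrite mulr_ge0 // ltW.
Qed.

Lemma strict_super_nonempty : strict_super M !=set0.
Proof.
exists (\sum_i \sum_j M i j + 1), (fun=> 1) => // i; rewrite mulr1.
under eq_bigr do rewrite mulr1.
apply: (@le_lt_trans _ _ (\sum_i \sum_j M i j)); last by rewrite ltrDl.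
rewrite [leRHS](bigD1 i) //= lerDl.
by apply: sumr_ge0 => k _; apply: sumr_ge0.
Qed.

(* If some [x_i < 0], the index minimizing [x_i / v_i] violates [M x <= t x]. *)
Lemma strict_super_monotone t (x : 'I_m -> R) : strict_super M t ->
  (forall i, \sum_j M i j * x j <= t * x i) -> forall i, 0 <= x i.
Proof.
move=> [v v0 vP] xP i0; rewrite leNgt; apply/negP => xi0.
have [i _ iP] : exists2 i, true & forall j, x i / v i <= x j / v j.
  case: (arg_minP (fun i => x i / v i) (isT : xpredT i0)) => i _ iP.
  by exists i => // j; apply: iP.
set th := x i / v i in iP.
have th0 : th < 0.
  by apply: le_lt_trans (iP i0) _; rewrite ltr_pdivrMr // mul0r.
have xi : x i = th * v i by rewrite divfK // gt_eqF.
have xj j : th * v j <= x j by rewrite -ler_pdivlMr.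
have := xP i; rewrite leNgt => /negP; apply.
apply: (@lt_le_trans _ _ (\sum_j M i j * (th * v j))); last first.
  by apply: ler_sum => j _; rewrite ler_wpM2l.
under eq_bigr do rewrite mulrCA.
by rewrite -mulr_sumr xi mulrCA ltr_nM2l.
Qed.

Let r := inf (strict_super M).

Let r_inf : has_inf (strict_super M).
Proof.
split; first exact: strict_super_nonempty.
by exists 0 => t /strict_super_pos/ltW.
Qed.

Let r_ge0 : 0 <= r.
Proof.
apply: lb_le_inf; first exact: strict_super_nonempty.
by move=> t /strict_super_pos/ltW.
Qed.

Let strict_super_gt t : r < t -> strict_super M t.
Proof.
move=> rt; have [|s sS st] := @inf_adherent _ (strict_super M) (t - r) _ r_inf.
  by rewrite subr_gt0.
by apply: strict_super_up sS _; apply/ltW; rewrite addrC subrK in st.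
Qed.

Let strict_super_inf : ~ strict_super M r.
Proof.
case/strict_super_open => t tr tS; have := @ge_inf _ _ r_inf.2 t tS.
by rewrite leNgt tr.
Qed.

(** Were [r - M] invertible, the solution [x] of [r x - M x = 1] would be nonnegative by
    monotonicity just above [r], then positive, so that [M x < r x] would put the infimum [r] itself
    into a set that is open to the left. *)
Let singular : \det (r%:M - M) = 0.
Proof.
apply: contrapT => /eqP; rewrite -unitfE -/(_ \in unitmx) => A_unit.
pose x := invmx (r%:M - M) *m const_mx 1 : 'cV_m.
have xE i : r * x i 0 - \sum_j M i j * x j 0 = 1.
  have : ((r%:M - M) *m x) i 0 = 1 by rewrite mulKVmx // mxE.
  by rewrite mulmxBl mul_scalar_mx !mxE.
(* With [d] times the absolute value of each [x i 0] at most 1, the identity [M x = r x - 1] yields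
   [M x <= (r + d) x] whatever the signs. *)
have [|d d0 dP] := @finite_lower_bound _ predT (fun i => (`|x i 0| + 1)^-1).
  by move=> i _; rewrite invr_gt0 ltr_wpDl.
have x0 i : 0 <= x i 0.
  apply: (@strict_super_monotone (r + d) (x ^~ 0)).
    by apply: strict_super_gt; rewrite ltrDl.
  move=> j; rewrite -subr_ge0 mulrDl addrAC xE.
  have := dP j isT; rewrite -(ler_pM2r (_ : 0 < `|x j 0| + 1)) ?ltr_wpDl //.
  rewrite mulVf ?gt_eqF ?ltr_wpDl // mulrDr mulr1 => H.
  have : d * - x j 0 <= d * `|x j 0| by rewrite ler_pM2l // -normrN ler_norm.
  by rewrite mulrN; lra.
apply: strict_super_inf; exists (x ^~ 0) => i; last first.
  by have := xE i; lra.
have ri : 0 < r * x i 0.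
  have := xE i; have : 0 <= \sum_j M i j * x j 0.
    by apply: sumr_ge0 => j _; rewrite mulr_ge0.
  lra.
rewrite lt_neqAle x0 andbT; apply/eqP => xi.
by rewrite -xi mulr0 ltxx in ri.
Qed.

Hypothesis M_irr : forall i j, connect (positive_digraph M) i j.

(* A null row vector [w] of [r - M] gives [z = |w|] with [r z <= z M]; pairing with
   vectors [v > 0] such that [M v < t v], [t -> r], forces equality. *)
Lemma perron_left : exists r u,
  [/\ 0 <= r, (forall i, 0 < u i) & forall j, \sum_i u i * M i j = r * u j].
Proof.
(* The denominator [r + 1] lets one [d] serve both [z], where [z M = r z], and every [v] with
   [M v < (r + s) v] and [s <= 1]. *)
have [d d0 dP] := @finite_lower_bound _
  (fun ij : 'I_m * 'I_m => 0 < M ij.1 ij.2) (fun ij => M ij.1 ij.2 / (r + 1))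
  (fun ij h => divr_gt0 h (ltr_wpDl r_ge0 ltr01)).
have r1 : 0 < r + 1 by rewrite ltr_wpDl.
have /eqP/det0P[w w0 wM] := singular.
pose z i := `|w 0 i|.
have z0 i : 0 <= z i by rewrite /z.
have zM j : r * z j <= \sum_i z i * M i j.
  have -> : r * z j = `| \sum_i w 0 i * M i j |.
    have /matrixP/(_ 0 j) := wM; rewrite mulmxBr mul_mx_scalar !mxE => /eqP.
    by rewrite subr_eq0 => /eqP <-; rewrite normrM (ger0_norm r_ge0).
  apply: le_trans (ler_norm_sum _ _ _) _; apply: ler_sum => i _.
  by rewrite normrM (ger0_norm (M0 _ _)).
have [k zk] : exists k, 0 < z k.
  have /matrix0Pn[i [k]] := w0; rewrite ord1 => wk.
  by exists k; rewrite /z normr_gt0.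
have zE j : \sum_i z i * M i j = r * z j.
  apply/eqP; rewrite eq_le zM andbT leNgt; apply/negP => zj.
  have [c c0 cP] := harnack d0 M_irr.
  pose D := \sum_i z i * M i j - r * z j.
  have D0 : 0 < D by rewrite subr_gt0.
  pose Z := \sum_i z i.
  have Z0 : 0 < Z.
    rewrite /Z (bigD1 k) //= ltr_pwDl //; exact: sumr_ge0.
  (* Pairing leaves the excess [D * v j] against [s] times the sum of [z i * v i]. By Harnack the
     latter is at most [s * Z * v j / c], hence the required size of [s]. *)
  have [s [s0 s1 sD]] : exists s, [/\ 0 < s, s <= 1 & s * Z < c * D].
    have h0 : 0 < c * D / Z by rewrite divr_gt0 // mulr_gt0.
    exists (Order.min 1 (c * D / Z / 2)); split.
    - by rewrite lt_min ltr01 divr_gt0.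
    - by rewrite ge_min lexx.
    - rewrite -ltr_pdivlMr // gt_min; apply/orP; right; lra.
  have [|v v0 vP] := @strict_super_gt (r + s); first by rewrite ltrDl.
  have vh i l : c * v l <= v i.
    apply: cP => [a|a b ab]; first exact: ltW.
    apply: le_trans (_ : M a b / (r + 1) * v b <= _).
      by rewrite ler_wpM2r ?(ltW (v0 _)) // (dP (a, b)).
    rewrite mulrAC ler_pdivrMr //.
    apply: (@le_trans _ _ (\sum_l M a l * v l)).
      rewrite (bigD1 b) //= lerDl; apply: sumr_ge0 => l' _.
      by rewrite mulr_ge0 // ltW.
    apply: le_trans (ltW (vP a)) _.
    by rewrite mulrC ler_pM2l // lerD2l.
  have P1 : \sum_i z i * (\sum_l M i l * v l) <= (r + s) * \sum_i z i * v i.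
    rewrite mulr_sumr; apply: ler_sum => i _.
    by rewrite mulrCA ler_wpM2l // ltW.
  have P2 : D * v j + r * \sum_i z i * v i <= \sum_i z i * (\sum_l M i l * v l).
    rewrite [leRHS](_ : _ = \sum_l (\sum_i z i * M i l) * v l); last first.
      under eq_bigr do rewrite mulr_sumr.
      rewrite exchange_big; apply: eq_bigr => l _; rewrite mulr_suml.
      by apply: eq_bigr => i _; rewrite mulrA.
    rewrite mulr_sumr (bigD1 j) //= [leRHS](bigD1 j) //= addrA.
    rewrite /D mulrBl mulrA subrK lerD2l.
    by apply: ler_sum => l _; rewrite mulrA ler_wpM2r // ltW.
  have P3 : c * (s * \sum_i z i * v i) < c * (D * v j).
    apply: (@le_lt_trans _ _ (s * Z * v j)); last first.
      by rewrite mulrA ltr_pM2r.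
    rewrite [leLHS]mulrCA -[leRHS]mulrA ler_pM2l // [leLHS]mulr_sumr /Z mulr_suml.
    by apply: ler_sum => i _; rewrite mulrCA ler_wpM2l.
  rewrite ltr_pM2l // in P3; lra.
exists r, z; split => // i.
have [c c0 cP] := harnack d0 (positive_digraph_tr M_irr).
apply: lt_le_trans (cP z z0 _ i k); first exact: mulr_gt0.
move=> a b; rewrite /positive_digraph mxE => ba.
apply: le_trans (_ : M b a / (r + 1) * z b <= _).
  by rewrite ler_wpM2r // (dP (b, a)).
rewrite mulrAC ler_pdivrMr //.
apply: (@le_trans _ _ (r * z a)); last by rewrite mulrC ler_wpM2l // lerDl.
rewrite -zE (bigD1 b) //= mulrC lerDl; apply: sumr_ge0 => l _.
exact: mulr_ge0.
Qed.

(** For a left eigenvector [w] the vector of absolute values satisfies [l |w| <= |w| M]; pairing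
    with the positive [v] replaces [M] by [s]. *)
Lemma eigenvalue_le (s : R) v l : (forall i, 0 < v i) ->
  (forall i, \sum_j M i j * v j = s * v i) -> eigenvalue M l -> l <= s.
Proof.
move=> v0 vP /eigenvalueP[w wM /matrix0Pn[i0 [k]]]; rewrite ord1 => wk.
have P : 0 < \sum_j `|w 0 j| * v j.
  rewrite (bigD1 k) //= ltr_pwDl ?mulr_gt0 ?normr_gt0 //.
  by apply: sumr_ge0 => j _; rewrite mulr_ge0 // ltW.
rewrite -(ler_pM2r P); apply: (@le_trans _ _ (\sum_j `|l * w 0 j| * v j)).
  rewrite mulr_sumr; apply: ler_sum => j _.
  by rewrite mulrA ler_wpM2r ?(ltW (v0 _)) // normrM ler_wpM2r // ler_norm.
apply: (@le_trans _ _ (\sum_j (\sum_i `|w 0 i| * M i j) * v j)).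
  apply: ler_sum => j _; rewrite ler_wpM2r ?(ltW (v0 _)) //.
  have /matrixP/(_ 0 j) := wM; rewrite !mxE => <-.
  apply: le_trans (ler_norm_sum _ _ _) _; apply: ler_sum => i _.
  by rewrite normrM (ger0_norm (M0 _ _)).
under eq_bigr do rewrite mulr_suml.
rewrite exchange_big mulr_sumr; apply: ler_sum => i _.
by rewrite mulrCA -vP mulr_sumr; under eq_bigr do rewrite -mulrA.
Qed.

End Nonneg.

(** The right vector is a left vector of the transpose. Both roots agree because [u M v] can be
    computed from either side and the pairing of two positive vectors is nonzero. *)
Theorem perron_frobenius M : (0 < m)%N -> (forall i j, 0 <= M i j) ->
  (forall i j, connect (positive_digraph M) i j) ->
  exists r u v,
  [/\ largest_eigenvalue M r,
      forall i, 0 < u i, forall j, \sum_i u i * M i j = r * u j,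
      forall i, 0 < v i & forall i, \sum_j M i j * v j = r * v i].
Proof.
move=> hm M0 Mc; have [r [u [r0 u0 uM]]] := perron_left hm M0 Mc.
have [|r' [v [_ v0 vM]]] := perron_left hm _ (positive_digraph_tr Mc).
  by move=> i j; rewrite mxE.
have {}vM i : \sum_j M i j * v j = r' * v i.
  by rewrite -vM; apply: eq_bigr => j _; rewrite mxE mulrC.
have rr' : r = r'.
  apply: (@mulIf _ (\sum_i u i * v i)).
    rewrite gt_eqF // (bigD1 (Ordinal hm)) //= ltr_pwDl ?mulr_gt0 //.
    by apply: sumr_ge0 => i _; rewrite mulr_ge0 // ltW.
  rewrite !mulr_sumr.
  under eq_bigr do rewrite mulrA -uM mulr_suml.
  rewrite exchange_big; apply: eq_bigr => i _.
  by rewrite mulrCA -vM mulr_sumr; apply: eq_bigr => j _; rewrite mulrA.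
rewrite -rr' in vM; exists r, u, v; split=> //; split.
  apply/eigenvalueP; exists (\row_i u i).
    by apply/rowP => j; rewrite !mxE -uM; apply: eq_bigr => i _; rewrite mxE.
  by apply/matrix0Pn; exists 0, (Ordinal hm); rewrite mxE gt_eqF.
by move=> l; apply: eigenvalue_le v0 vM.
Qed.

End Perron.

(** * Sums of nonnegative families and polynomials *)

Section ExtendedSums.
Variables (R : realType) (T : choiceType).
Implicit Types (f a b : T -> R).

Lemma esumZl f c : 0 <= c -> (forall x, 0 <= f x) ->
  \esum_(x in [set: T]) (c * f x)%:E = (c%:E * \esum_(x in [set: T]) (f x)%:E)%E.
Proof.
have le d (h : T -> R) : 0 <= d -> (forall x, 0 <= h x) ->
    (\esum_(x in [set: T]) (d * h x)%:E <= d%:E * \esum_(x in [set: T]) (h x)%:E)%E.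
  move=> d0 h0; apply: ge_ereal_sup => _ [X [finX _] <-].
  under eq_fsbigr do rewrite EFinM.
  rewrite -ge0_mule_fsumr; last by move=> x; rewrite lee_fin.
  by rewrite lee_wpmul2l ?lee_fin //; apply: esum_ge; exists X.
move=> c0 f0; apply/eqP; rewrite eq_le le //=.
have [->|cn0] := eqVneq c 0.
  by rewrite mul0e; apply: esum_ge0 => x _; rewrite mul0r.
have cp : 0 < c by rewrite lt_neqAle eq_sym cn0.
rewrite -lee_pdivlMl //.
have := le c^-1 (fun x => c * f x); rewrite invr_ge0 => /(_ c0) H.
under eq_esum do rewrite -[f _](mulKf cn0).
by apply: H => x; rewrite mulr_ge0.
Qed.

Lemma esum_ge_term f x : (forall x, 0 <= f x) ->
  ((f x)%:E <= \esum_(x in [set: T]) (f x)%:E)%E.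
Proof.
move=> f0; apply: esum_ge; exists [set x] => //.
by rewrite fsbig_set1.
Qed.

(** The increment of a single term is moved to the left side, so the strict gain is kept even if the
    sums are infinite. *)
Lemma esum_lt_term a b x : (forall x, 0 <= a x) -> (forall x, a x <= b x) ->
  (\esum_(x in [set: T]) (a x)%:E + (b x - a x)%:E
     <= \esum_(x in [set: T]) (b x)%:E)%E.
Proof.
move=> a0 ab; pose d y := if y == x then b x - a x else 0.
have d0 y : 0 <= d y by rewrite /d; case: ifP => //; rewrite subr_ge0.
apply: (@le_trans _ _ (\esum_(x in [set: T]) (a x + d x)%:E)); last first.
  apply: le_esum => y _; rewrite lee_fin /d; case: eqP => [->|_].
    by rewrite addrC subrK.
  by rewrite addr0.
under [leRHS]eq_esum do rewrite EFinD.
rewrite esumD; [|by move=> *; rewrite lee_fin..].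
by rewrite leeD2l // -[b x - a x](_ : d x = _) ?esum_ge_term // /d eqxx.
Qed.

Lemma sum_le_esum (s : seq T) f : uniq s -> (forall x, 0 <= f x) ->
  ((\sum_(x <- s) f x)%:E <= \esum_(x in [set: T]) (f x)%:E)%E.
Proof.
move=> us f0; apply: esum_ge; exists [set` s] => //.
by rewrite -fsbig_seq // sumEFin.
Qed.

Lemma ler_sum_support (s s' : seq T) f : uniq s -> uniq s' ->
  (forall x, 0 <= f x) -> (forall x, x \in s -> f x != 0 -> x \in s') ->
  \sum_(x <- s) f x <= \sum_(x <- s') f x.
Proof.
move=> us us' f0 ss'; rewrite (bigID (fun x => f x != 0)) /=.
rewrite [X in _ + X]big1 => [|x /negPn/eqP //]; rewrite addr0 -big_filter.
rewrite (perm_big [seq x <- s' | (x \in s) && (f x != 0)]); last first.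
  apply: uniq_perm; rewrite ?filter_uniq // => x; rewrite !mem_filter.
  by case xs: (x \in s); case fx: (f x != 0) => //=; rewrite ss'.
by rewrite big_filter big_mkcond; apply: ler_sum => x _; case: ifP.
Qed.

Lemma esum_le_exhaustion (s : nat -> seq T) f B :
  (forall N, uniq (s N)) -> (forall x, 0 <= f x) ->
  (forall r : seq T, exists N, {subset r <= s N}) ->
  (forall N, \sum_(x <- s N) f x <= B) ->
  (\esum_(x in [set: T]) (f x)%:E <= B%:E)%E.
Proof.
move=> us f0 hs hB; apply: ge_ereal_sup => _ [X [finX _] <-].
rewrite fsbig_finite //= sumEFin lee_fin.
have [N sN] := hs (finmap.enum_fset (fset_set X)); apply: le_trans (hB N).
by apply: ler_sum_support => // x /sN.
Qed.

End ExtendedSums.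

(** * Convexity estimates for polynomials with nonnegative coefficients *)

Section NonnegPoly.
Variable R : realFieldType.
Implicit Types p q : {poly R}.

Definition nneg_poly p := forall i, 0 <= p`_i.

Lemma nneg_polyM p q : nneg_poly p -> nneg_poly q -> nneg_poly (p * q).
Proof.
by move=> p0 q0 i; rewrite coefM; apply: sumr_ge0 => j _; rewrite mulr_ge0.
Qed.

Lemma nneg_polyXn p n : nneg_poly p -> nneg_poly (p ^+ n).
Proof.
move=> p0; elim: n => [|n IH]; last by rewrite exprS; apply: nneg_polyM.
by move=> i; rewrite expr0 coef1 ler0n.
Qed.

Lemma nneg_poly_prod (I : Type) (r : seq I) (F : I -> {poly R}) :
  (forall i, nneg_poly (F i)) -> nneg_poly (\prod_(i <- r) F i).
Proof.
move=> F0; elim/big_ind: _ => //; last exact: nneg_polyM.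
by move=> i; rewrite coef1 ler0n.
Qed.

Lemma nneg_polyC c : 0 <= c -> nneg_poly c%:P.
Proof. by move=> c0 i; rewrite coefC; case: ifP. Qed.

Lemma nneg_poly_horner p s t : nneg_poly p -> 0 <= s -> s <= t ->
  0 <= p.[s] <= p.[t].
Proof.
move=> p0 s0 st; rewrite !horner_coef; apply/andP; split.
  by apply: sumr_ge0 => i _; rewrite mulr_ge0 ?p0 ?exprn_ge0.
apply: ler_sum => i _; rewrite ler_wpM2l ?p0 //. rewrite lerXn2r ?nnegrE //.
exact: le_trans s0 st.
Qed.

Lemma poly_split2 p : p = (p`_0)%:P + p`_1 *: 'X + drop_poly 2 p * 'X^2.
Proof.
rewrite -[LHS](poly_take_drop 2); congr (_ + _); apply/polyP => i.
rewrite coef_take_poly coefD coefC coefZ coefX.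
by case: i => [|[|i]] /=; rewrite ?mulr0 ?mulr1 ?addr0 ?add0r.
Qed.

Lemma horner_split2 p s : p.[s] = p`_0 + s * p`_1 + s ^+ 2 * (drop_poly 2 p).[s].
Proof.
rewrite [in LHS](poly_split2 p) !(hornerD, hornerM, hornerC, hornerZ, hornerX, hornerXn).
ring.
Qed.

Lemma deriv_at0 p : p^`().[0] = p`_1.
Proof. by rewrite horner_coef0 coef_deriv mulr1n. Qed.

Lemma nneg_drop p n : nneg_poly p -> nneg_poly (drop_poly n p).
Proof. by move=> p0 i; rewrite coef_drop_poly. Qed.

Lemma nneg_deriv p : nneg_poly p -> nneg_poly p^`().
Proof. by move=> p0 i; rewrite coef_deriv mulrn_wge0. Qed.

Lemma nneg_poly_tangent p : nneg_poly p -> p.[0] + p^`().[0] <= p.[1].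
Proof.
move=> p0; rewrite deriv_at0 horner_coef0 horner_split2 mul1r expr1n mul1r lerDl.
by case/andP: (nneg_poly_horner (nneg_drop 2 p0) ler01 (lexx 1)).
Qed.

(** Writing [p = p_0 + p_1 X + q X^2], the remainder [s^2 q(s)] is at most [s^2 q(t)], and
    [t^2 q(t) <= p(t)]. The error thus involves only a value of [p], not a second derivative. *)
Lemma nneg_poly_quadratic p s t : nneg_poly p -> 0 <= s -> s <= t -> 0 < t ->
  p.[s] <= p.[0] + s * p^`().[0] + (s / t) ^+ 2 * p.[t].
Proof.
move=> p0 s0 st t0; rewrite deriv_at0 horner_coef0 horner_split2 lerD2l.
have t2 : 0 < t ^+ 2 by rewrite exprn_gt0.
rewrite expr_div_n -[leRHS]mulrA ler_wpM2l ?sqr_ge0 // [leRHS]mulrC ler_pdivlMr //.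
case/andP: (nneg_poly_horner (nneg_drop 2 p0) s0 st) => q0 qst.
rewrite (horner_split2 _ t) ler_wpDl ?addr_ge0 ?mulr_ge0 ?p0 ?(ltW t0) //.
by rewrite mulrC ler_wpM2l // ltW.
Qed.

(** With [p = p_0 + p_1 X + q X^2], the right side exceeds [p(1)] by exactly [q(1) + q'(1)]. The
    term [q(1)] is kept because it detects degree at least two. *)
Lemma nneg_poly_cotangent p : nneg_poly p ->
  p.[1] + (drop_poly 2 p).[1] <= p.[0] + p^`().[1].
Proof.
move=> p0; have -> : p^`().[1] =
    p`_1 + 2 * (drop_poly 2 p).[1] + (drop_poly 2 p)^`().[1].
  rewrite [in LHS](poly_split2 p) !(derivD, derivM, derivC, derivZ, derivX, derivXn).
  rewrite !(hornerD, hornerM, hornerMn, hornerC, hornerZ, hornerX, hornerXn).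
  ring.
rewrite horner_split2 !horner_coef0.
have [/andP[q0 _] /andP[q1 _]] := (nneg_poly_horner (nneg_drop 2 p0) ler01 (lexx 1),
  nneg_poly_horner (nneg_deriv (nneg_drop 2 p0)) ler01 (lexx 1)).
lra.
Qed.

Lemma deriv_prod (I : finType) (F : I -> {poly R}) :
  (\prod_i F i)^`() = \sum_i (F i)^`() * \prod_(j | j != i) F j.
Proof.
elim: (index_enum I) (index_enum_uniq I) => [|a r IH].
  by rewrite !big_nil derivC.
move=> /= /andP[ar ur]; rewrite !big_cons derivM IH // eqxx /=; congr (_ * _ + _).
  rewrite big_seq_cond [RHS]big_seq_cond; apply: eq_bigl => i.
  rewrite andbT; case ir: (i \in r) => //=.
  by apply/esym/eqP => E; rewrite -E ir in ar.
rewrite mulr_sumr big_seq [RHS]big_seq; apply: eq_bigr => i ir.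
rewrite big_cons ifT; first by rewrite mulrCA.
by apply/eqP => E; rewrite E ir in ar.
Qed.

Lemma nneg_poly_coef_le p i : nneg_poly p -> p`_i <= p.[1].
Proof.
move=> p0; have [ip|/leq_sizeP/(_ i (leqnn i)) ->] := ltnP i (size p).
  rewrite horner_coef (bigD1 (Ordinal ip)) //= expr1n mulr1 lerDl.
  by apply: sumr_ge0 => j _; rewrite expr1n mulr1.
by case/andP: (nneg_poly_horner p0 ler01 (lexx 1)).
Qed.

Lemma coefM_gt0 p q i j : nneg_poly p -> nneg_poly q ->
  0 < p`_i -> 0 < q`_j -> 0 < (p * q)`_(i + j).
Proof.
move=> p0 q0 pi qj; rewrite coefM.
have ij : (i < (i + j).+1)%N by rewrite ltnS leq_addr.
rewrite (bigD1 (Ordinal ij)) //= addKn ltr_pwDl ?mulr_gt0 //.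
by apply: sumr_ge0 => k _; rewrite mulr_ge0.
Qed.

Lemma exp_coef_gt0 p n : nneg_poly p -> 0 < p`_1 -> 0 < (p ^+ n)`_n.
Proof.
move=> p0 p1; elim: n => [|n IH]; first by rewrite expr0 coef1 ltr01.
by rewrite exprS -add1n coefM_gt0 //; apply: nneg_polyXn.
Qed.

Lemma prod_coef_gt0 (I : finType) (F : I -> {poly R}) (d : I -> nat) :
  (forall i, nneg_poly (F i)) -> (forall i, 0 < (F i)`_(d i)) ->
  0 < (\prod_i F i)`_(\sum_i d i).
Proof.
move=> F0 Fd; elim: (index_enum I) => [|a r IH].
  by rewrite !big_nil coef1 ltr01.
by rewrite !big_cons coefM_gt0 //; apply: nneg_poly_prod.
Qed.
End NonnegPoly.

(** * Values of power series and their derivatives *)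

Section Evaluation.
Variables (R : realType) (m : nat).
Implicit Types (g : pwser R m) (q : nat * {ffun 'I_m -> nat}).
Implicit Types (x s : R) (y w : 'I_m -> R).

Definition mono q x y : R := x ^+ q.1 * \prod_(j < m) y j ^+ q.2 j.

(* The factor [q.2 j] makes up for the truncated subtraction at [q.2 j = 0]. *)
Definition dmono (j : 'I_m) q x y : R :=
  (q.2 j)%:R * (x ^+ q.1 * \prod_(i < m) y i ^+ (q.2 i - (i == j))).

Definition pval g x y : \bar R :=
  \esum_(q in [set: nat * {ffun 'I_m -> nat}]) (g q * mono q x y)%:E.

Definition dval j g x y : \bar R :=
  \esum_(q in [set: nat * {ffun 'I_m -> nat}]) (g q * dmono j q x y)%:E.

Lemma pwvalE g (p : point R m) : pwval g p = pval g p.1 (p.2 0).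
Proof. by []. Qed.

(** The monomial [q] along the line [y + s w], as a polynomial in [s]; it transfers the one-variable
    estimates to several variables. *)
Definition line_poly q x y w : {poly R} :=
  (x ^+ q.1)%:P * \prod_j (w j *: 'X + (y j)%:P) ^+ q.2 j.

Lemma line_polyE q x y w s :
  (line_poly q x y w).[s] = mono q x (fun j => y j + s * w j).
Proof.
rewrite /line_poly hornerM hornerC horner_prod; congr (_ * _).
by apply: eq_bigr => j _; rewrite horner_exp !hornerE addrC mulrC.
Qed.

Lemma deriv_line_polyE q x y w s : (line_poly q x y w)^`().[s] =
  \sum_j w j * dmono j q x (fun j => y j + s * w j).
Proof.
rewrite /line_poly derivM derivC mul0r add0r deriv_prod hornerM hornerC.
rewrite horner_sum mulr_sumr; apply: eq_bigr => j _.
rewrite hornerM deriv_exp hornerMn horner_prod /dmono [in RHS](bigD1 j) //= eqxx subn1.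
rewrite derivD derivZ derivX derivC addr0 hornerM horner_exp !hornerE /=.
rewrite (addrC (w j * s)) (mulrC (w j) s) -mulr_natl.
set A := (y j + s * w j) ^+ _.
rewrite (eq_bigr (fun i => (y i + s * w i) ^+ (q.2 i - (i == j)))) => [|i ij].
  ring.
by rewrite horner_exp !hornerE (negPf ij) subn0 addrC mulrC.
Qed.

Lemma nneg_line_poly q x y w : 0 <= x -> (forall j, 0 <= y j) ->
  (forall j, 0 <= w j) -> nneg_poly (line_poly q x y w).
Proof.
move=> x0 y0 w0; apply: nneg_polyM; first exact/nneg_polyC/exprn_ge0.
apply: nneg_poly_prod => j; apply: nneg_polyXn => i.
by rewrite coefD coefZ coefX coefC addr_ge0 ?mulr_ge0 ?ler0n //; case: ifP.
Qed.

Lemma mono_ge0 q x y : 0 <= x -> (forall j, 0 <= y j) -> 0 <= mono q x y.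
Proof.
by move=> x0 y0; rewrite mulr_ge0 ?exprn_ge0 // prodr_ge0 // => j _; rewrite exprn_ge0.
Qed.

Lemma dmono_ge0 j q x y : 0 <= x -> (forall j, 0 <= y j) -> 0 <= dmono j q x y.
Proof.
move=> x0 y0; rewrite mulr_ge0 ?ler0n // mulr_ge0 ?exprn_ge0 // prodr_ge0 // => i _.
by rewrite exprn_ge0.
Qed.

Lemma mono_le q x x' y y' : 0 <= x -> x <= x' ->
  (forall j, 0 <= y j) -> (forall j, y j <= y' j) -> mono q x y <= mono q x' y'.
Proof.
move=> x0 xx' y0 yy'; apply: ler_pM; rewrite ?exprn_ge0 //.
- by rewrite prodr_ge0 // => j _; rewrite exprn_ge0.
- by rewrite lerXn2r ?nnegrE // (le_trans x0 xx').
- apply: ler_prod => j _; rewrite exprn_ge0 //=.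
  by rewrite lerXn2r ?nnegrE // (le_trans (y0 j) (yy' j)).
Qed.

Lemma mono_tangent q x y w : 0 <= x -> (forall j, 0 <= y j) -> (forall j, 0 <= w j) ->
  mono q x y + \sum_j w j * dmono j q x y <= mono q x (fun j => y j + w j).
Proof.
move=> x0 y0 w0; have := nneg_poly_tangent (nneg_line_poly q x0 y0 w0).
rewrite !line_polyE deriv_line_polyE.
have e0 : (fun j => y j + 0 * w j) = y by apply/funext => j; rewrite mul0r addr0.
have e1 : (fun j => y j + 1 * w j) = (fun j => y j + w j).
  by apply/funext => j; rewrite mul1r.
by rewrite e0 e1.
Qed.

Lemma mono_quadratic q x y w s t : 0 <= x -> (forall j, 0 <= y j) ->
  (forall j, 0 <= w j) -> 0 <= s -> s <= t -> 0 < t ->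
  mono q x (fun j => y j + s * w j) <= mono q x y + s * (\sum_j w j * dmono j q x y)
     + (s / t) ^+ 2 * mono q x (fun j => y j + t * w j).
Proof.
move=> x0 y0 w0 s0 st t0.
have := nneg_poly_quadratic (nneg_line_poly q x0 y0 w0) s0 st t0.
rewrite !line_polyE deriv_line_polyE.
have -> // : (fun j => y j + 0 * w j) = y by apply/funext => j; rewrite mul0r addr0.
Qed.

Lemma mono_cotangent q x y w : 0 <= x -> (forall j, 0 <= y j) -> (forall j, 0 <= w j) ->
  mono q x (fun j => y j + w j) + (drop_poly 2 (line_poly q x y w)).[1] <=
  mono q x y + \sum_j w j * dmono j q x (fun j => y j + w j).
Proof.
move=> x0 y0 w0; have := nneg_poly_cotangent (nneg_line_poly q x0 y0 w0).
rewrite !line_polyE deriv_line_polyE.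
have -> : (fun j => y j + 0 * w j) = y by apply/funext => j; rewrite mul0r addr0.
by have -> // : (fun j => y j + 1 * w j) = (fun j => y j + w j);
  apply/funext => j; rewrite mul1r.
Qed.

(** The coefficient of degree equal to the total [y]-degree contains [x ^+ q.1] times the product of
    the [w j ^+ q.2 j], which is positive, and it survives dropping the two lowest coefficients. *)
Lemma line_poly_curved q x y w : 0 < x -> (forall j, 0 <= y j) ->
  (forall j, 0 < w j) -> (1 < \sum_j q.2 j)%N ->
  0 < (drop_poly 2 (line_poly q x y w)).[1].
Proof.
move=> x0 y0 w0 q2; set P := line_poly q x y w.
have P0 : nneg_poly P by apply: nneg_line_poly => // [|j]; exact: ltW.
have Q0 := nneg_drop 2 P0.
suff H : 0 < P`_(\sum_j q.2 j).
  apply: lt_le_trans (nneg_poly_coef_le (\sum_j q.2 j - 2) Q0).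
  by rewrite coef_drop_poly addnC subnKC.
rewrite coefCM mulr_gt0 ?exprn_gt0 //.
have F0 j : nneg_poly (w j *: 'X + (y j)%:P).
  move=> i; rewrite coefD coefZ coefX coefC.
  by rewrite addr_ge0 ?mulr_ge0 ?ler0n ?(ltW (w0 j)) //; case: ifP.
apply: prod_coef_gt0 => j; first exact: nneg_polyXn.
apply: exp_coef_gt0 => //.
by rewrite coefD coefZ coefX coefC mulr1 addr0.
Qed.

(** Raising the [j]-th exponent is injective, and the monomials it misses do not contain [y_j], so
    their terms in [dval] vanish. *)
Lemma pval_pderiv j g x y : pval (pderiv j g) x y = dval j g x y.
Proof.
pose e q : nat * {ffun 'I_m -> nat} := (q.1, [ffun i => (q.2 i + (i == j))%N]).
have ei : injective e.
  move=> [k1 a1] [k2 a2] [-> /ffunP E]; congr (_, _); apply/ffunP => i.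
  by have := E i; rewrite !ffunE => /addIn.
transitivity (\esum_(q in e @` setT) (g q * dmono j q x y)%:E).
  rewrite (esum_image setT e); last by move=> ? ? _ _ /ei.
  apply: eq_esum => q _; rewrite /pderiv /dmono /e /= ffunE eqxx addn1.
  rewrite -mulrA mulrCA; congr (_ * (_ * (_ * _)))%:E.
  by apply: eq_bigr => i _; rewrite ffunE addnK.
rewrite esum_mkcond /dval; apply: eq_esum => -[k a] _; case: ifPn => //.
rewrite notin_setE /= => eq; rewrite /dmono /=.
case: (posnP (a j)) => [->|aj]; first by rewrite mul0r mulr0.
case: eq; exists (k, [ffun i => (a i - (i == j))%N]) => //; congr (_, _).
apply/ffunP => i; rewrite !ffunE subnK //.
by case: eqP => [->|].
Qed.

Section Monotone.
Variable g : pwser R m.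
Hypothesis g0 : forall q, 0 <= g q.

Lemma pval_ge0 x y : 0 <= x -> (forall j, 0 <= y j) -> (0 <= pval g x y)%E.
Proof.
by move=> x0 y0; apply: esum_ge0 => q _; rewrite lee_fin mulr_ge0 ?mono_ge0.
Qed.

Lemma dval_ge0 j x y : 0 <= x -> (forall j, 0 <= y j) -> (0 <= dval j g x y)%E.
Proof.
by move=> x0 y0; apply: esum_ge0 => q _; rewrite lee_fin mulr_ge0 ?dmono_ge0.
Qed.

Lemma pval_le x x' y y' : 0 <= x -> x <= x' ->
  (forall j, 0 <= y j) -> (forall j, y j <= y' j) -> (pval g x y <= pval g x' y')%E.
Proof.
move=> x0 xx' y0 yy'; apply: le_esum => q _.
by rewrite lee_fin ler_wpM2l // mono_le.
Qed.

Lemma pval_ge_term q x y : 0 <= x -> (forall j, 0 <= y j) ->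
  ((g q * mono q x y)%:E <= pval g x y)%E.
Proof.
move=> x0 y0; apply: (@esum_ge_term _ _ (fun q => g q * mono q x y)) => q'.
by rewrite mulr_ge0 ?mono_ge0.
Qed.

Lemma sum_dvalE w x y : 0 <= x -> (forall j, 0 <= y j) -> (forall j, 0 <= w j) ->
  (\sum_j (w j)%:E * dval j g x y = \esum_(q in [set: nat * {ffun 'I_m -> nat}])
     (g q * \sum_j w j * dmono j q x y)%:E)%E.
Proof.
move=> x0 y0 w0.
under [RHS]eq_esum do rewrite mulr_sumr -sumEFin.
rewrite esum_sum => [|q j _ _]; last by rewrite lee_fin mulr_ge0 // mulr_ge0 ?dmono_ge0.
apply: eq_bigr => j _; rewrite -esumZl // => [|q]; last by rewrite mulr_ge0 ?dmono_ge0.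
by apply: eq_esum => q _; rewrite mulrCA.
Qed.

Lemma pval_tangent x y w : 0 <= x -> (forall j, 0 <= y j) -> (forall j, 0 <= w j) ->
  (pval g x y + \sum_j (w j)%:E * dval j g x y <= pval g x (fun j => y j + w j)%R)%E.
Proof.
move=> x0 y0 w0; rewrite sum_dvalE // -esumD => [|q _|q _]; last 2 first.
- by rewrite lee_fin mulr_ge0 ?mono_ge0.
- by rewrite lee_fin mulr_ge0 ?sumr_ge0 // => j _; rewrite mulr_ge0 ?dmono_ge0.
apply: le_esum => q _; rewrite -EFinD lee_fin -mulrDr ler_wpM2l //.
exact: mono_tangent.
Qed.

Lemma pval_quadratic x y w s t : 0 <= x -> (forall j, 0 <= y j) ->
  (forall j, 0 <= w j) -> 0 <= s -> s <= t -> 0 < t ->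
  (pval g x (fun j => y j + s * w j)%R <=
   pval g x y + s%:E * \sum_j (w j)%:E * dval j g x y
   + ((s / t) ^+ 2)%:E * pval g x (fun j => y j + t * w j)%R)%E.
Proof.
move=> x0 y0 w0 s0 st t0; rewrite sum_dvalE //.
have yt0 j : 0 <= y j + t * w j by rewrite addr_ge0 // mulr_ge0 // ltW.
have S0 q : 0 <= \sum_j w j * dmono j q x y.
  by rewrite sumr_ge0 // => j _; rewrite mulr_ge0 ?dmono_ge0.
rewrite -esumZl // => [|q]; last by rewrite mulr_ge0.
rewrite -esumZl ?sqr_ge0 // => [|q]; last by rewrite mulr_ge0 ?mono_ge0.
have c0 : 0 <= (s / t) ^+ 2 by rewrite sqr_ge0.
have A0 q : 0 <= g q * mono q x y by rewrite mulr_ge0 ?mono_ge0.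
have B0 q : 0 <= s * (g q * \sum_j w j * dmono j q x y) by rewrite !mulr_ge0.
have C0 q : 0 <= (s / t) ^+ 2 * (g q * mono q x (fun j => y j + t * w j)).
  by rewrite mulr_ge0 // mulr_ge0 ?mono_ge0.
rewrite -!esumD => [|q _|q _|q _|q _]; rewrite -?EFinD ?lee_fin ?addr_ge0 //.
apply: le_esum => q _; rewrite -!EFinD lee_fin.
have H := mono_quadratic q x0 y0 w0 s0 st t0.
apply: le_trans (ler_wpM2l (g0 q) H) _.
by rewrite !mulrDr (mulrCA (g q) s) (mulrCA (g q) (_ ^+ 2)).
Qed.

Lemma pval_cotangent x y w : 0 <= x -> (forall j, 0 <= y j) -> (forall j, 0 <= w j) ->
  (pval g x (fun j => y j + w j)%R <=
   pval g x y + \sum_j (w j)%:E * dval j g x (fun j => y j + w j)%R)%E.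
Proof.
move=> x0 y0 w0; have yw0 j : 0 <= y j + w j by rewrite addr_ge0.
rewrite sum_dvalE // -esumD => [|q _|q _]; last 2 first.
- by rewrite lee_fin mulr_ge0 ?mono_ge0.
- by rewrite lee_fin mulr_ge0 ?sumr_ge0 // => j _; rewrite mulr_ge0 ?dmono_ge0.
apply: le_esum => q _; rewrite -EFinD lee_fin -mulrDr ler_wpM2l //.
apply: le_trans (mono_cotangent q x0 y0 w0); rewrite lerDl.
by case/andP: (nneg_poly_horner (nneg_drop 2 (nneg_line_poly q x0 y0 w0)) ler01 (lexx 1)).
Qed.

(** The gap is the curvature contributed by the single term [q]; this is how nonlinearity of the
    system enters. *)
Lemma pval_cotangent_gap x y w q : 0 < x -> (forall j, 0 <= y j) ->
  (forall j, 0 < w j) -> 0 < g q -> (1 < \sum_j q.2 j)%N ->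
  exists2 d, 0 < d &
  (pval g x (fun j => y j + w j)%R + d%:E <=
   pval g x y + \sum_j (w j)%:E * dval j g x (fun j => y j + w j)%R)%E.
Proof.
move=> x0 y0 w0 gq q2; have w0' j : 0 <= w j by apply: ltW.
have x0' := ltW x0; have yw0 j : 0 <= y j + w j by rewrite addr_ge0.
exists (g q * (drop_poly 2 (line_poly q x y w)).[1]).
  by rewrite mulr_gt0 // line_poly_curved.
rewrite sum_dvalE // -esumD => [|q' _|q' _]; last 2 first.
- by rewrite lee_fin mulr_ge0 ?mono_ge0.
- by rewrite lee_fin mulr_ge0 ?sumr_ge0 // => j _; rewrite mulr_ge0 ?dmono_ge0.
apply: (@le_trans _ _ (\esum_(q in [set: nat * {ffun 'I_m -> nat}]) (g q * (mono q x y
  + \sum_j w j * dmono j q x (fun j => y j + w j)))%:E)%E); last first.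
  by apply: le_esum => q' _; rewrite -EFinD mulrDr.
have ct q' := mono_cotangent q' x0' y0 w0'.
apply: le_trans (esum_lt_term (a := fun q => g q * mono q x (fun j => y j + w j)) q _ _).
- rewrite leeD2l // lee_fin -mulrBr ler_wpM2l // lerBrDl; exact: ct.
- by move=> q'; rewrite mulr_ge0 ?mono_ge0.
- move=> q'; rewrite ler_wpM2l //; apply: le_trans (ct q'); rewrite lerDl.
  by case/andP: (nneg_poly_horner (nneg_drop 2 (nneg_line_poly q' x0' y0 w0')) ler01 (lexx 1)).
Qed.

(** A pure power of [x] keeps the gap positive even where coordinates of [y] vanish, since
    [0 ^+ 0 = 1]. *)
Lemma pval_x_gap x x' y q : 0 <= x -> x < x' -> (forall j, 0 <= y j) ->
  0 < g q -> (0 < q.1)%N -> q.2 = [ffun=> 0%N] ->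
  exists2 d, 0 < d & (pval g x y + d%:E <= pval g x' y)%E.
Proof.
move=> x0 xx' y0 gq q1 q2; exists (g q * mono q x' y - g q * mono q x y).
  rewrite subr_gt0 ltr_pM2l // /mono ltr_pM2r.
    by rewrite ltrXn2r ?nnegrE ?(ltW (le_lt_trans x0 xx')) // -lt0n.
  by rewrite prodr_gt0 // => j _; rewrite q2 ffunE expr0.
apply: esum_lt_term => q'; first by rewrite mulr_ge0 ?mono_ge0.
by rewrite ler_wpM2l // mono_le // ltW.
Qed.

(** Convexity of powers of [x] between [x] and [x + t], with the weight [1 - s / t] of the first
    endpoint enlarged to 1. It controls the dependence on [x] without a derivative in [x]. *)
Lemma pval_x_interpolate x s t y : 0 <= x -> 0 <= s -> s <= t -> 0 < t ->
  (forall j, 0 <= y j) ->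
  (pval g (x + s)%R y <= pval g x y + (s / t)%:E * pval g (x + t)%R y)%E.
Proof.
move=> x0 s0 st t0 y0; have t0' := ltW t0.
rewrite -esumZl ?divr_ge0 // => [|q]; last by rewrite mulr_ge0 ?mono_ge0 ?addr_ge0.
have A0 q : 0 <= g q * mono q x y by rewrite mulr_ge0 ?mono_ge0.
have B0 q : 0 <= s / t * (g q * mono q (x + t) y).
  by rewrite mulr_ge0 ?divr_ge0 // mulr_ge0 // mono_ge0 ?addr_ge0.
rewrite -esumD => [|q _|q _]; rewrite ?lee_fin //.
apply: le_esum => q _; rewrite -EFinD lee_fin [s / t * _]mulrCA -mulrDr ler_wpM2l //.
rewrite /mono mulrA -mulrDl ler_wpM2r ?prodr_ge0 // => [j _|]; first by rewrite exprn_ge0.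
have h3 : s = s / t * t by rewrite divfK // gt_eqF.
set a := s / t in h3 *; have a0 : 0 <= a by rewrite divr_ge0.
have a1 : a <= 1 by rewrite ler_pdivrMr // mul1r.
clearbody a; rewrite h3.
apply: (@le_trans _ _ ((1 - a) * x ^+ q.1 + a * (x + t) ^+ q.1)); last first.
  by rewrite lerD2r ler_piMl ?exprn_ge0 // gerBl.
elim: q.1 => [|n IH]; first by rewrite !expr0; lra.
have x1 : 0 <= x + a * t by rewrite addr_ge0 ?mulr_ge0.
rewrite exprS; apply: le_trans (ler_wpM2l x1 IH) _.
have h2 : x ^+ n <= (x + t) ^+ n by rewrite lerXn2r ?nnegrE ?addr_ge0 // lerDl.
rewrite !exprS; set X := x ^+ n in h2 *; set Y := (x + t) ^+ n in h2 *.
clearbody X Y.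
(* This product is exactly the difference of the two sides in the inductive step of convexity. *)
have k1 : 0 <= a * t * (1 - a) * (Y - X) by rewrite !mulr_ge0 // subr_ge0.
lra.
Qed.

(** Every monomial that occurs has a positive exponent [k] of [x], and [s ^+ k <= s]. *)
Lemma pval_x_scale s x y : (forall al, g (0%N, al) = 0) -> 0 <= s -> s <= 1 ->
  0 <= x -> (forall j, 0 <= y j) -> (pval g (s * x)%R y <= s%:E * pval g x y)%E.
Proof.
move=> gx s0 s1 x0 y0.
rewrite -esumZl // => [|q]; last by rewrite mulr_ge0 ?mono_ge0.
apply: le_esum => -[[|k] al] _; rewrite lee_fin.
  by rewrite gx !mul0r mulr0.
rewrite [leRHS]mulrCA ler_wpM2l // /mono [leRHS]mulrA ler_wpM2r ?prodr_ge0 // => [j _|].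
  by rewrite exprn_ge0.
rewrite /= exprMn ler_wpM2r ?exprn_ge0 // exprS ler_piMr //.
exact: exprn_ile1.
Qed.

End Monotone.
End Evaluation.

(** * Partial sums of the standard solution *)

Section Exponents.
Variable m : nat.

Definition exponents N (ka : 'I_N.+1 * {ffun 'I_m -> 'I_N.+1}) :
  nat * {ffun 'I_m -> nat} := (ka.1 : nat, [ffun j => ka.2 j : nat]).

(** The index range of the double sum in [subst_coef], as a list of exponents, so that ranges for
    different [N] can be compared. *)
Definition box N : seq (nat * {ffun 'I_m -> nat}) :=
  map (@exponents N) (index_enum _).

Lemma box_uniq N : uniq (box N).
Proof.
rewrite map_inj_uniq ?index_enum_uniq // => -[k1 a1] [k2 a2] [/val_inj -> /ffunP E].
by congr (_, _); apply/ffunP => i; have := E i; rewrite !ffunE => /val_inj.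
Qed.

Lemma mem_box N q : (q \in box N) = (q.1 <= N)%N && [forall j, (q.2 j <= N)%N].
Proof.
apply/mapP/andP => [[[k a] _ ->] /=|[qk /forallP qa]].
  split; first by rewrite -ltnS.
  by apply/forallP => j; rewrite ffunE -ltnS.
exists (inord q.1, [ffun j => inord (q.2 j)]); first exact: mem_index_enum.
case: q qk qa => k a /= ka aa; congr (_, _); first by rewrite inordK.
by apply/ffunP => j; rewrite !ffunE inordK // ltnS.
Qed.

Lemma box_exhaustive (r : seq (nat * {ffun 'I_m -> nat})) :
  exists N, {subset r <= box N}.
Proof.
elim: r => [|q r [N rN]]; first by exists 0%N.
pose N' := (maxn N (maxn q.1 (\max_j q.2 j)))%N.
exists N' => q'; rewrite inE => /orP[/eqP ->|/rN]; rewrite !mem_box.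
  rewrite /N' !leq_max leqnn orbT /=; apply/forallP => j.
  by rewrite !leq_max (leq_bigmax j) !orbT.
case/andP=> k1 /forallP a1; rewrite leq_max k1 /=; apply/forallP => j.
by rewrite leq_max a1.
Qed.

End Exponents.

Section CoefBound.
Variable R : realFieldType.
Implicit Types p q : {poly R}.

(** Truncations at different orders are comparable only in low degrees. Nonnegativity is included so
    that the relation is stable under products. *)
Definition coef_le_below n p q := forall i, (i < n)%N -> 0 <= p`_i <= q`_i.

Lemma coef_le_belowM n p p' q q' : coef_le_below n p p' -> coef_le_below n q q' ->
  coef_le_below n (p * q) (p' * q').
Proof.
move=> pp' qq' i ni; rewrite !coefM; apply/andP.
have P (j : 'I_i.+1) : 0 <= p`_j <= p'`_j.
  by apply: pp'; apply: leq_trans ni; rewrite ltn_ord.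
have Q (j : 'I_i.+1) : 0 <= q`_(i - j) <= q'`_(i - j).
  by apply: qq'; apply: leq_ltn_trans ni; rewrite leq_subr.
split; [apply: sumr_ge0|apply: ler_sum] => j _;
  case/andP: (P j) => p0 pp; case/andP: (Q j) => q0 qq; [exact: mulr_ge0|exact: ler_pM].
Qed.

Lemma coef_le_below1 n : coef_le_below n 1 1.
Proof. by move=> i _; rewrite lexx coef1 ler0n. Qed.

Lemma coef_le_belowX n p p' k : coef_le_below n p p' -> coef_le_below n (p ^+ k) (p' ^+ k).
Proof.
move=> pp'; elim: k => [|k IH]; first exact: coef_le_below1.
by rewrite !exprS; apply: coef_le_belowM.
Qed.

Lemma coef_le_below_prod n (I : Type) (r : seq I) (F F' : I -> {poly R}) :
  (forall i, coef_le_below n (F i) (F' i)) ->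
  coef_le_below n (\prod_(i <- r) F i) (\prod_(i <- r) F' i).
Proof.
move=> FF'; elim: r => [|a r IH]; first by rewrite !big_nil; apply: coef_le_below1.
by rewrite !big_cons; apply: coef_le_belowM.
Qed.

Lemma partial_sum_le_horner p (x : R) N : nneg_poly p -> 0 <= x ->
  \sum_(l < N) p`_l * x ^+ l <= p.[x].
Proof.
move=> p0 x0; rewrite (horner_coef_wide _ (leq_maxr N (size p))).
rewrite -!(big_mkord predT (fun l => p`_l * x ^+ l)).
rewrite [leRHS](@big_cat_nat _ _ _ N) ?leq_maxl //= lerDl.
by apply: sumr_ge0 => i _; rewrite mulr_ge0 ?p0 ?exprn_ge0.
Qed.

End CoefBound.

Section Solution.
Variables (R : realType) (m : nat).
Implicit Types (q : nat * {ffun 'I_m -> nat}) (T : 'I_m -> nat -> R).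

Definition mono_poly q (P : 'I_m -> {poly R}) : {poly R} :=
  'X^(q.1) * \prod_(j < m) P j ^+ q.2 j.

Definition trunc T n (j : 'I_m) : {poly R} := \poly_(l < n.+1) T j l.

Definition psum T n (x : R) (j : 'I_m) : R := (trunc T n j).[x].

Lemma mono_polyE q P x : (mono_poly q P).[x] = mono q x (fun j => (P j).[x]).
Proof.
rewrite hornerM hornerXn horner_prod; congr (_ * _).
by apply: eq_bigr => j _; rewrite horner_exp.
Qed.

Lemma subst_coefE g T n :
  subst_coef g T n = \sum_(q <- box m n) g q * (mono_poly q (trunc T n))`_n.
Proof.
rewrite /subst_coef pair_bigA big_map; apply: eq_bigr => -[k a] _ /=.
by rewrite /mono_poly /=; under [in RHS]eq_bigr do rewrite ffunE.
Qed.

(** Without constant terms, each factor of the monomial contributes at least one power of [X], so an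
    exponent above [l] leaves nothing in degree [l]. *)
Lemma mono_poly_coef0 q (P : 'I_m -> {poly R}) l : (forall j, (P j)`_0 = 0) -> q \notin box m l ->
  (mono_poly q P)`_l = 0.
Proof.
move=> P0; rewrite mem_box negb_and -ltnNge; case: ltnP => [kl _|_] /=.
  by rewrite coefXnM kl.
rewrite negb_forall => /existsP[j]; rewrite -ltnNge => lj.
have -> : mono_poly q P = 'X^(q.1) * (drop_poly 1 (P j)) ^+ q.2 j *
    \prod_(i | i != j) P i ^+ q.2 i * 'X^(q.2 j).
  rewrite /mono_poly (bigD1 j) //= -{1}(poly_take_drop 1 (P j)).
  have -> : take_poly 1 (P j) = 0.
    by apply/polyP => -[|i]; rewrite coef_take_poly coef0 //= P0.
  by rewrite add0r expr1 exprMn -!mulrA (mulrC 'X^(q.2 j)).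
by rewrite coefMXn lj.
Qed.

Section Standard.
Variables (G : pwsys R m) (T : 'I_m -> nat -> R).
Hypotheses (G0 : forall i q, 0 <= G i q) (Gx : forall i al, G i (0%N, al) = 0).
Hypothesis hT : standard_solution G T.

Let T_ge0 i n : 0 <= T i n. Proof. by case: hT. Qed.
Let T_0 i : T i 0%N = 0. Proof. by case: hT. Qed.
Let TE i n : T i n = \sum_(q <- box m n) G i q * (mono_poly q (trunc T n))`_n.
Proof. by case: hT => _ _ ->; rewrite subst_coefE. Qed.

Let trunc_ge0 n j : nneg_poly (trunc T n j).
Proof. by move=> i; rewrite coef_poly; case: ifP. Qed.

Let mono_trunc_ge0 q n : nneg_poly (mono_poly q (trunc T n)).
Proof.
apply: nneg_polyM => [i|]; first by rewrite coefXn ler0n.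
by apply: nneg_poly_prod => j; apply: nneg_polyXn.
Qed.

Lemma psumE n x i : psum T n x i = \sum_(l < n.+1) T i l * x ^+ l.
Proof. by rewrite /psum horner_poly. Qed.

Lemma psum0 x i : psum T 0 x i = 0.
Proof. by rewrite psumE big_ord_recl big_ord0 T_0 mul0r addr0. Qed.

Lemma psum_ge0 n x i : 0 <= x -> 0 <= psum T n x i.
Proof. by move=> x0; case/andP: (nneg_poly_horner (trunc_ge0 n i) x0 (lexx x)). Qed.

Lemma psum_nondecreasing x i : 0 <= x -> nondecreasing_seq (fun n => psum T n x i).
Proof.
move=> x0; apply/nondecreasing_seqP => n; rewrite !psumE [leRHS]big_ord_recr /=.
by rewrite lerDl mulr_ge0 ?exprn_ge0.
Qed.

(* Since [x] divides [G], the coefficient of [x^l] only involves [T] below [l]. *)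
Lemma psum_subsolution n x i : 0 <= x ->
  ((psum T n.+1 x i)%:E <= pval (G i) x (psum T n x))%E.
Proof.
move=> x0; apply: le_trans (sum_le_esum (box_uniq m n.+1) _); last first.
  by move=> q; rewrite mulr_ge0 // mono_ge0 // => j; apply: psum_ge0.
rewrite lee_fin psumE.
apply: (@le_trans _ _ (\sum_(l < n.+2) (\sum_(q <- box m n.+1)
    G i q * (mono_poly q (trunc T n))`_l) * x ^+ l)).
  apply: ler_sum => l _; rewrite ler_wpM2r ?exprn_ge0 // TE.
  apply: (@le_trans _ _ (\sum_(q <- box m l) G i q * (mono_poly q (trunc T n))`_l)).
    apply: ler_sum => -[[|k] al] _; first by rewrite Gx !mul0r.
    rewrite ler_wpM2l // !coefXnM; case: ltnP => // kl.
    have : (l - k.+1 < l)%N by rewrite ltn_subrL /= (leq_trans _ kl).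
    move: (l - k.+1)%N => l' l'l; suff /(_ l' l'l)/andP[] :
      coef_le_below l (\prod_(j < m) trunc T l j ^+ al j)
                      (\prod_(j < m) trunc T n j ^+ al j) by [].
    apply: coef_le_below_prod => j; apply: coef_le_belowX => a al'.
    rewrite !coef_poly ltnS (ltnW al') T_ge0 /=.
    by rewrite (leq_trans al') // -ltnS ltn_ord.
  apply: ler_sum_support (box_uniq _ _) (box_uniq _ _) _ _ => [q|q].
    by rewrite mulr_ge0 ?mono_trunc_ge0.
  rewrite !mem_box => /andP[k1 /forallP a1] _.
  have ln : (l <= n.+1)%N by rewrite -ltnS.
  rewrite (leq_trans k1 ln); apply/forallP => j.
  exact: leq_trans (a1 j) ln.
under eq_bigr do rewrite mulr_suml.
rewrite exchange_big; apply: ler_sum => q _ /=.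
under eq_bigr do rewrite -mulrA.
rewrite -mulr_sumr ler_wpM2l // -mono_polyE.
exact: partial_sum_le_horner.
Qed.

(** A finite part of [G(x, S_n(x))] is a polynomial in [x] whose coefficients are at most those of
    [T]; [D] bounds its degree. *)
Lemma psum_supersolution N n x i : 0 <= x ->
  exists D, \sum_(q <- box m N) G i q * mono q x (psum T n x) <= psum T D x i.
Proof.
move=> x0; pose P q := mono_poly q (trunc T n).
pose D := (\max_(q <- box m N) size (P q))%N; exists D.
rewrite psumE (@le_trans _ _ (\sum_(l < D.+1)
    (\sum_(q <- box m N) G i q * (P q)`_l) * x ^+ l)) //.
  under [leRHS]eq_bigr do rewrite mulr_suml.
  rewrite exchange_big /= le_eqVlt; apply/orP; left; apply/eqP.
  apply: eq_big_seq => q qN; under eq_bigr do rewrite -mulrA.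
  rewrite -mulr_sumr -mono_polyE -horner_coef_wide //.
  by apply: leqW; apply: (@leq_bigmax_seq _ _ _ (fun q => size (P q))).
apply: ler_sum => l _; rewrite ler_wpM2r ?exprn_ge0 // TE.
apply: (@le_trans _ _ (\sum_(q <- box m N) G i q * (mono_poly q (trunc T l))`_l)).
  apply: ler_sum => q _; rewrite ler_wpM2l //.
  suff /(_ l (ltnSn l))/andP[] :
    coef_le_below l.+1 (P q) (mono_poly q (trunc T l)) by [].
  apply: coef_le_belowM.
    by move=> a _; rewrite lexx coefXn ler0n.
  apply: coef_le_below_prod => j; apply: coef_le_belowX => a al.
  by rewrite !coef_poly al; case: ifP; rewrite ?T_ge0 lexx.
apply: ler_sum_support (box_uniq _ _) (box_uniq _ _) _ _ => [q|q _].
  by rewrite mulr_ge0 ?mono_trunc_ge0.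
apply: contraR => ql; rewrite mono_poly_coef0 ?mulr0 // => j.
by rewrite coef_poly /= T_0.
Qed.

Lemma psum_le_super x b : 0 <= x -> (forall j, 0 <= b j) ->
  (forall j, (pval (G j) x b <= (b j)%:E)%E) -> forall n j, psum T n x j <= b j.
Proof.
move=> x0 b0 bP; elim=> [|n IH] j; first by rewrite psum0.
rewrite -lee_fin; apply: le_trans (psum_subsolution _ _ x0) _.
apply: le_trans (bP j); apply: pval_le => // k; exact: psum_ge0.
Qed.

(** Each box sum is a polynomial, hence passes to the limit in [n]; the boxes then exhaust the
    series. The bound [B] must hold for all [N] and [n] jointly. *)
Lemma cvg_pval_le g x (t : 'I_m -> R) B : (forall q, 0 <= g q) -> 0 <= x ->
  (forall j, (fun n => psum T n x j) @ \oo --> t j) ->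
  (forall N n, \sum_(q <- box m N) g q * mono q x (psum T n x) <= B) ->
  (pval g x t <= B%:E)%E.
Proof.
move=> g0 x0 tP gB.
have t0 j : 0 <= t j.
  by apply: (cvgr_to_ge (tP j)); apply: nearW => n; apply: psum_ge0.
apply: (esum_le_exhaustion (box_uniq m)) => [q||N].
- by rewrite mulr_ge0 ?mono_ge0.
- exact: box_exhaustive.
apply: (@cvgr_to_le nat \oo _ R
  (fun n => \sum_(q <- box m N) g q * mono q x (psum T n x))); last exact: nearW.
apply: cvg_big => [|q _]; first exact: add_continuous.
apply: cvgM; first exact: cvg_cst.
apply: cvgM; first exact: cvg_cst.
apply: cvg_big => [|j _]; first exact: mul_continuous.
elim: (q.2 j) => [|k IH]; first exact: cvg_cst.
by under eq_cvg do rewrite exprS; rewrite exprS; apply: cvgM.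
Qed.

Lemma psum_le_lim x (t : 'I_m -> R) j n : 0 <= x ->
  (fun n => psum T n x j) @ \oo --> t j -> psum T n x j <= t j.
Proof.
move=> x0 tj; apply: (cvgr_to_ge tj); near=> k.
by apply: psum_nondecreasing => //; near: k; exists n.
Unshelve. all: by end_near. Qed.

(** Monotone partial sums squeeze the value from both sides, so the equation holds also at the end
    of the interval of convergence. *)
Lemma solution_at x (t : 'I_m -> R) : 0 <= x ->
  (forall j, (fun n => psum T n x j) @ \oo --> t j) ->
  forall i, pval (G i) x t = (t i)%:E.
Proof.
move=> x0 tP i; have tl n j : psum T n x j <= t j by apply: psum_le_lim.
apply/eqP; rewrite eq_le; apply/andP; split.
  apply: cvg_pval_le => // N n; have [D] := psum_supersolution N n i x0.
  by move=> /le_trans; apply.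
have pn n : ((psum T n x i)%:E <= pval (G i) x t)%E.
  apply: (@le_trans _ _ (psum T n.+1 x i)%:E).
    by rewrite lee_fin; apply: psum_nondecreasing.
  apply: le_trans (psum_subsolution _ _ x0) _.
  apply: pval_le => // j; exact: psum_ge0.
case E: (pval (G i) x t) pn => [v| |] pn; first last.
- by have := pn 0%N; rewrite leeNy_eq.
- by rewrite leey.
rewrite lee_fin; apply: (cvgr_to_le (tP i)); apply: nearW => n.
by rewrite -lee_fin.
Qed.

End Standard.
End Solution.

(** * The extreme point *)

(** The pairing of [u] with [J w - w] is zero, while all its terms are nonnegative and [u] is
    positive. *)
Lemma left_fixed_rigid (R : realDomainType) (m : nat) (J : 'I_m -> 'I_m -> R)
    (u w : 'I_m -> R) : (forall i, 0 < u i) ->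
  (forall j, \sum_i u i * J i j = u j) -> (forall i, w i <= \sum_j J i j * w j) ->
  forall i, w i = \sum_j J i j * w j.
Proof.
move=> u0 uJ wJ i; apply/esym/eqP; rewrite -subr_eq0.
suff /psumr_eq0P/(_ i isT)/eqP : \sum_i u i * (\sum_j J i j * w j - w i) = 0.
  rewrite mulf_eq0 gt_eqF //= => H; apply: H => k _.
  by rewrite mulr_ge0 ?subr_ge0 // ltW.
under eq_bigr do rewrite mulrBr mulr_sumr.
rewrite sumrB exchange_big /=; apply/eqP; rewrite subr_eq0; apply/eqP.
apply: eq_bigr => j _; under eq_bigr do rewrite mulrA.
by rewrite -mulr_suml uJ.
Qed.

Section WellConditioned.
Variables (R : realType) (m : nat) (hm : (0 < m)%N) (G : pwsys R m).
Hypothesis hG : well_conditioned G.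
Implicit Types (a x : R) (b y w : 'I_m -> R).

Let G0 : forall i q, 0 <= G i q := wc_nneg hG.
Let Gx : forall i al, G i (0%N, al) = 0 := wc_x0 hG.

Lemma pderiv_ge0 i j q : 0 <= pderiv j (G i) q.
Proof. by rewrite mulr_ge0 ?ler0n. Qed.

Lemma dval_le i j a b b' : 0 <= a -> (forall k, 0 <= b k) -> (forall k, b k <= b' k) ->
  (dval j (G i) a b <= dval j (G i) a b')%E.
Proof.
by move=> a0 b0 bb'; rewrite -!pval_pderiv; apply: pval_le => // q; apply: pderiv_ge0.
Qed.

Lemma dval_gt0 i j a b : 0 < a -> (forall k, 0 < b k) -> dependency G i j ->
  (0 < dval j (G i) a b)%E.
Proof.
move=> a0 b0 /asboolP[q /eqP qn0]; rewrite -pval_pderiv.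
have q0 : 0 < pderiv j (G i) q by rewrite lt_neqAle eq_sym qn0 pderiv_ge0.
apply: lt_le_trans (pval_ge_term (@pderiv_ge0 i j) q _ _) => [||k]; last 2 first.
- exact: ltW.
- exact: ltW.
rewrite lte_fin mulr_gt0 // mulr_gt0 ?exprn_gt0 // prodr_gt0 // => k _.
by rewrite exprn_gt0.
Qed.

(** As [fine] sends +oo to 0, this is the true derivative only where [dval] is finite. *)
Definition jac a b (i j : 'I_m) : R := fine (dval j (G i) a b).

Lemma jacE a b i j : 0 <= a -> (forall k, 0 <= b k) ->
  (dval j (G i) a b < +oo)%E -> dval j (G i) a b = (jac a b i j)%:E.
Proof. by move=> a0 b0 fin; rewrite fineK // ge0_fin_numE ?dval_ge0. Qed.

Lemma jac_ge0 a b i j : 0 <= a -> (forall k, 0 <= b k) -> 0 <= jac a b i j.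
Proof. by move=> a0 b0; rewrite fine_ge0 ?dval_ge0. Qed.

Lemma sum_jacE a b w i : 0 <= a -> (forall k, 0 <= b k) ->
  (forall j, (dval j (G i) a b < +oo)%E) ->
  (\sum_j (w j)%:E * dval j (G i) a b = (\sum_j jac a b i j * w j)%:E)%E.
Proof.
move=> a0 b0 fin; rewrite -sumEFin; apply: eq_bigr => j _.
by rewrite (jacE a0 b0 (fin j)) -EFinM mulrC.
Qed.

Lemma jac_irreducible a b i j : 0 < a -> (forall k, 0 < b k) ->
  (forall i j, (dval j (G i) a b < +oo)%E) ->
  connect (fun i j => 0 < jac a b i j) i j.
Proof.
move=> a0 b0 fin; have b0' k : 0 <= b k by apply: ltW.
have /connect_sub := wc_irr hG i j; apply => {}i {}j ij; apply: connect1.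
by rewrite -lte_fin -jacE ?(ltW a0) // dval_gt0.
Qed.

Lemma nonlinear_term : exists i q, 0 < G i q /\ (1 < \sum_j q.2 j)%N.
Proof.
have [i [j [k [q /eqP H]]]] := wc_nonlinear hG.
exists i; eexists; split.
  rewrite lt_neqAle G0 andbT eq_sym.
  by move: H; rewrite /pderiv !mulf_eq0 !negb_or => /and3P[_ _]; exact.
under eq_bigr do rewrite !ffunE /=.
rewrite !big_split /= -addnA.
have E (l : 'I_m) : (\sum_(i < m) (i == l))%N = 1%N.
  by rewrite (bigD1 l) //= eqxx big1 // => i0 /negPf ->.
by rewrite !E addn1 addn2.
Qed.

Lemma x_term i : exists q, [/\ 0 < G i q, (0 < q.1)%N & q.2 = [ffun=> 0%N]].
Proof.
have [k /eqP H] := wc_y0 hG i; exists (k, [ffun=> 0%N]); split=> //=.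
  by rewrite lt_neqAle eq_sym H G0.
by case: k H => //; rewrite Gx eqxx.
Qed.

(** At a real point [(h, h)] of the polydisc [G] is finite, and shrinking [x] alone to [s' * h]
    scales its value by at most [s'], hence below [h]. This yields [rho > 0]. *)
Lemma small_supersolution :
  exists x b, [/\ 0 < x, forall j, 0 <= b j & forall j, (pval (G j) x b <= (b j)%:E)%E].
Proof.
have [r r0 rP] := wc_holo hG; pose h := r / 2.
have h0 : 0 < h by rewrite divr_gt0.
have nh : ComplexField.Normc.normc (h%:C)%C < r.
  by rewrite /= expr0n addr0 sqrtr_sqr gtr0_norm // /h; lra.
have fin i : (pval (G i) h (fun=> h) < +oo)%E.
  have := rP _ (fun=> (h%:C)%C) nh (fun=> nh) i.
  rewrite /abs_cvg_at; congr (_ < _)%E; apply: eq_esum => q _; congr EFin.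
  under eq_bigr do rewrite -rmorphXn.
  rewrite -rmorphXn -rmorph_prod -!rmorphM /= expr0n addr0 sqrtr_sqr ger0_norm //.
  by rewrite mulr_ge0 // mono_ge0 // => [|j]; apply: ltW.
pose K i := fine (pval (G i) h (fun=> h)).
have K0 i : 0 <= K i by rewrite fine_ge0 // pval_ge0 // => *; apply: ltW.
have KE i : pval (G i) h (fun=> h) = (K i)%:E.
  by rewrite fineK // ge0_fin_numE // pval_ge0 // => *; apply: ltW.
have [s s0 sP] := @finite_lower_bound R 'I_m predT (fun i => h / (K i + 1))
  (fun i _ => divr_gt0 h0 (ltr_wpDl (K0 i) ltr01)).
pose s' := Order.min s 1.
have s'0 : 0 < s' by rewrite lt_min s0 ltr01.
exists (s' * h), (fun=> h); split=> [|j|j]; [exact: mulr_gt0|exact: ltW|].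
have s'1 : s' <= 1 by rewrite ge_min lexx orbT.
apply: le_trans (pval_x_scale (G0 j) (Gx j) (ltW s'0) s'1 (ltW h0) (fun=> ltW h0)) _.
rewrite KE -EFinM lee_fin.
have := sP j isT; rewrite ler_pdivlMr ?ltr_wpDl // mulrDr mulr1 => H.
apply: le_trans (_ : s * K j <= _); last by lra.
by rewrite ler_wpM2r // ge_min lexx.
Qed.

Lemma jacobianE p i j : jacobian G p i j = jac p.1 (p.2 0) i j.
Proof. by rewrite mxE pwvalE pval_pderiv. Qed.

Lemma jacobian_dval_fin p : jacobian_finite G p ->
  forall i j, (dval j (G i) p.1 (p.2 0)%R < +oo)%E.
Proof. by move=> fin i j; have := fin i j; rewrite pwvalE pval_pderiv. Qed.

Lemma jacobian_perron p : positive_point p -> jacobian_finite G p ->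
  exists r u v,
  [/\ largest_eigenvalue (jacobian G p) r,
      forall i, 0 < u i, forall j, \sum_i u i * jac p.1 (p.2 0) i j = r * u j,
      forall i, 0 < v i & forall i, \sum_j jac p.1 (p.2 0) i j * v j = r * v i].
Proof.
move=> [a0 b0] /jacobian_dval_fin fin.
have [i j|i j|r [u [v [lr u0 uJ v0 vJ]]]] := perron_frobenius (M := jacobian G p) hm.
- by rewrite jacobianE jac_ge0 => // [|k]; apply: ltW.
- rewrite (@eq_connect _ _ (fun i j => 0 < jac p.1 (p.2 0) i j)) ?jac_irreducible //.
  by move=> k l; rewrite /positive_digraph jacobianE.
exists r, u, v; split=> // [j|i].
  by rewrite -uJ; apply: eq_bigr => i _; rewrite jacobianE.
by rewrite -vJ; apply: eq_bigr => j _; rewrite jacobianE.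
Qed.

(** * Jacobian at the extreme point and uniqueness of eigenpoints *)

Section Extreme.
Variables (rho : R) (t : 'I_m -> R) (T : 'I_m -> nat -> R).
Hypothesis hT : standard_solution G T.
Hypothesis T_radius : forall i, convergence_radius (T i) = rho%:E.
Hypothesis T_rho : forall i, pseries (T i) rho @ \oo --> t i.

(** [pseries] at index [n] stops before degree [n], while [psum] includes it; hence the shift. *)
Lemma pseries_psum i x n : pseries (T i) x n.+1 = psum T n x i.
Proof. by rewrite psumE /pseries /series /= big_mkord. Qed.

(** Bounded monotone partial sums converge, and one component suffices because all share the radius
    [rho]. *)
Lemma radius_ge x i B : 0 <= x -> (forall n, psum T n x i <= B) -> x <= rho.
Proof.
move=> x0 xB; rewrite -lee_fin -(T_radius i); apply: ereal_sup_ubound.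
exists x => //; split => //.
have : cvgn (fun n => psum T n x i).
  apply: nondecreasing_is_cvgn; first by move=> a b; apply: (psum_nondecreasing hT i x0).
  by exists B => _ [n _ <-].
have -> : (fun n => psum T n x i) = [sequence pseries (T i) x n.+1]_n.
  by apply/funext => n; rewrite -pseries_psum.
by move=> /cvg_ex[l]; rewrite cvg_shiftS => H; apply/cvg_ex; exists l.
Qed.

Lemma supersolution_le_radius x b : 0 <= x -> (forall j, 0 <= b j) ->
  (forall j, (pval (G j) x b <= (b j)%:E)%E) -> x <= rho.
Proof.
move=> x0 b0 bP; apply: (@radius_ge x (Ordinal hm) (b (Ordinal hm))) => // n.
exact: (psum_le_super G0 Gx hT).
Qed.

Lemma rho_gt0 : 0 < rho.
Proof.
have [x [b [x0 b0 bP]]] := small_supersolution.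
exact: lt_le_trans x0 (supersolution_le_radius (ltW x0) b0 bP).
Qed.

Let rho0 : 0 < rho := rho_gt0.
Let rho0' : 0 <= rho := ltW rho_gt0.

Lemma psum_rho j : (fun n => psum T n rho j) @ \oo --> t j.
Proof.
have -> : (fun n => psum T n rho j) = [sequence pseries (T j) rho n.+1]_n.
  by apply/funext => n; rewrite -pseries_psum.
by rewrite cvg_shiftS.
Qed.

Local Arguments psum_rho : clear implicits.

Lemma extreme_solution i : pval (G i) rho t = (t i)%:E.
Proof. exact: (solution_at G0 Gx hT rho0' psum_rho). Qed.

Lemma psum_le_t n j : psum T n rho j <= t j.
Proof. exact: (psum_le_lim hT n rho0' (psum_rho j)). Qed.

Let psum_rho_ge0 n j : 0 <= psum T n rho j.
Proof. exact: (psum_ge0 hT n j rho0'). Qed.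

Let t_ge0 j : 0 <= t j.
Proof. exact: le_trans (psum_le_t 0 j). Qed.

Lemma t_gt0 i : 0 < t i.
Proof.
have [q [q0 q1 q2]] := x_term i; rewrite -lte_fin -extreme_solution.
apply: lt_le_trans (pval_ge_term (G0 i) q rho0' t_ge0).
rewrite lte_fin mulr_gt0 // mulr_gt0 ?exprn_gt0 // prodr_gt0 // => j _.
by rewrite q2 ffunE.
Qed.

(* Otherwise [T_j] is a polynomial, with infinite radius of convergence. *)
Lemma psum_lt_t n j : psum T n rho j < t j.
Proof.
rewrite lt_neqAle psum_le_t andbT; apply/eqP => E.
have T0 k : (n < k)%N -> T j k = 0.
  case: k => // k nk; have : psum T k.+1 rho j <= psum T k rho j.
    by apply: le_trans (psum_le_t _ _) _; rewrite -E; apply: (psum_nondecreasing hT).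
  rewrite !psumE [leLHS]big_ord_recr /= gerDl pmulr_lle0 ?exprn_gt0 // => Tk.
  by apply/eqP; rewrite eq_le Tk; case: hT => ->.
have : rho + 1 <= rho; last by rewrite gerDl ler10.
apply: (@radius_ge _ j (psum T n (rho + 1) j)); first by rewrite addr_ge0.
elim=> [|k IH]; first by apply: (psum_nondecreasing hT); rewrite ?addr_ge0.
have [kn|nk] := leqP k.+1 n.
  by apply: (psum_nondecreasing hT); rewrite ?addr_ge0.
by rewrite psumE big_ord_recr /= -psumE T0 // mul0r addr0.
Qed.

Let gap n j : R := t j - psum T n rho j.
Let gap_gt0 n j : 0 < gap n j. Proof. by rewrite subr_gt0 psum_lt_t. Qed.

(** The tangent at [S_n] towards [tau] gives [G(S_n) + J(S_n) gap <= tau], and [G(S_n)] is at least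
    [S_(n+1)], hence at least [S_n]. It is stated in extended reals because it is the source of
    finiteness. *)
Lemma sum_dval_gap n i :
  (\sum_j (gap n j)%:E * dval j (G i) rho (psum T n rho) <= (gap n i)%:E)%E.
Proof.
have := pval_tangent (G0 i) rho0' (psum_rho_ge0 n) (fun j => ltW (gap_gt0 n j)).
have -> : (fun j => psum T n rho j + gap n j) = t.
  by apply/funext => j; rewrite addrC subrK.
rewrite extreme_solution => H.
rewrite /gap EFinB leeBrDr // addeC; apply: le_trans H.
rewrite leeD2r //; apply: le_trans (psum_subsolution G0 Gx hT n i rho0').
by rewrite lee_fin (psum_nondecreasing hT).
Qed.

Lemma dval_psum_fin n i j : (dval j (G i) rho (psum T n rho) < +oo)%E.
Proof.
rewrite ltey; apply/eqP => E; have := sum_dval_gap n i.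
rewrite (bigD1 j) //= E gt0_muley ?lte_fin // addye ?leye_eq //.
rewrite -ltNye; apply: (@lt_le_trans _ _ 0%E) => //.
by apply: sume_ge0 => k _; rewrite mule_ge0 ?lee_fin ?(ltW (gap_gt0 _ _)) ?dval_ge0.
Qed.

Lemma jac_gap n i : \sum_j jac rho (psum T n rho) i j * gap n j <= gap n i.
Proof.
rewrite -lee_fin -sum_jacE //; first exact: sum_dval_gap.
exact: dval_psum_fin.
Qed.

Lemma jac_psum_nondecreasing i j :
  nondecreasing_seq (fun n => jac rho (psum T n rho) i j).
Proof.
move=> n k nk; rewrite -lee_fin -!jacE ?dval_psum_fin //.
by apply: dval_le => // l; apply: (psum_nondecreasing hT).
Qed.

Local Arguments jac_psum_nondecreasing : clear implicits.

Lemma dval_t_le i j B : (forall n, jac rho (psum T n rho) i j <= B) ->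
  (dval j (G i) rho t <= B%:E)%E.
Proof.
move=> nB; rewrite -pval_pderiv.
apply: (cvg_pval_le hT (@pderiv_ge0 i j) rho0' psum_rho) => N n.
apply: le_trans (nB n); rewrite -lee_fin -jacE ?dval_psum_fin // -pval_pderiv.
apply: sum_le_esum; first exact: box_uniq.
by move=> q; rewrite mulr_ge0 ?pderiv_ge0 ?mono_ge0.
Qed.

(** A single term of the gap inequality gives [J_ij gap_j <= gap_i]. On edges [J] is bounded below
    from some [n0] on, so Harnack compares all gaps with one [c], and [J_ij] is at most [1 / c]. *)
Lemma dval_t_fin i j : (dval j (G i) rho t < +oo)%E.
Proof.
(* At [S_0 = 0] a nonzero derivative series may have value 0; positivity on edges needs positive
   partial sums. *)
have [n0 n0P] : exists n0, forall j, 0 < psum T n0 rho j.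
  suff : \forall n \near \oo, forall j, 0 < psum T n rho j.
    by move=> [n0 _ /(_ n0 (leqnn n0))]; exists n0.
  apply: filter_forall => k; exact: cvgr_gt (psum_rho k) _ (t_gt0 k).
have [|d d0 dP] := @finite_lower_bound R _
  (fun ij : 'I_m * 'I_m => dependency G ij.1 ij.2)
  (fun ij => jac rho (psum T n0 rho) ij.1 ij.2).
  by move=> [k l] /= kl; rewrite -lte_fin -jacE ?dval_psum_fin // dval_gt0.
have [c c0 cP] := harnack d0 (wc_irr hG).
have jacle n k l : jac rho (psum T n rho) k l * gap n l <= gap n k.
  apply: le_trans (jac_gap n k); rewrite (bigD1 l) //= lerDl sumr_ge0 // => l' _.
  by rewrite mulr_ge0 ?jac_ge0 ?(ltW (gap_gt0 _ _)).
have gapc n : (n0 <= n)%N -> forall k l, c * gap n l <= gap n k.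
  move=> nn; apply: cP => [k|k l kl]; first exact: ltW.
  apply: le_trans (jacle n k l); rewrite ler_pM2r //.
  apply: le_trans (dP (k, l) kl) _; exact: jac_psum_nondecreasing.
apply: le_lt_trans (ltry c^-1); apply: dval_t_le => n.
(* Indices below [n0] are covered by monotonicity in [n]. *)
apply: le_trans (_ : jac rho (psum T (maxn n n0) rho) i j <= _).
  by apply: jac_psum_nondecreasing; rewrite leq_maxl.
move: (maxn n n0) (leq_maxr n n0) => {}n nn.
rewrite -(ler_pM2r (gap_gt0 n j)); apply: le_trans (jacle n i j) _.
by rewrite mulrC ler_pdivlMr // mulrC gapc.
Qed.

Lemma jac_psum_cvg i j : (fun n => jac rho (psum T n rho) i j) @ \oo --> jac rho t i j.
Proof.
have le n : jac rho (psum T n rho) i j <= jac rho t i j.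
  rewrite -lee_fin -(jacE rho0' (psum_rho_ge0 n) (dval_psum_fin n i j)).
  rewrite -(jacE rho0' t_ge0 (dval_t_fin i j)).
  by apply: dval_le => // k; apply: psum_le_t.
have cv := nondecreasing_is_cvgn (jac_psum_nondecreasing i j).
have {}cv : cvgn (fun n => jac rho (psum T n rho) i j).
  by apply: cv; exists (jac rho t i j) => _ [n _ <-].
suff <- : limn (fun n => jac rho (psum T n rho) i j) = jac rho t i j by [].
apply/eqP; rewrite eq_le limr_le //=; last exact: nearW.
rewrite -lee_fin -(jacE rho0' t_ge0 (dval_t_fin i j)); apply: dval_t_le => n.
exact: nondecreasing_cvgn_le (jac_psum_nondecreasing i j) cv n.
Qed.

Local Arguments jac_psum_cvg : clear implicits.

(** If [r > 1], then [u J(S_n) > u] already for some [n], where the gap is still positive; pairing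
    with it contradicts [J(S_n) gap <= gap]. *)
Lemma left_eigenvalue_le1 r (u : 'I_m -> R) : (forall i, 0 < u i) ->
  (forall j, \sum_i u i * jac rho t i j = r * u j) -> r <= 1.
Proof.
move=> u0 uJ; rewrite leNgt; apply/negP => r1.
have [n nP] : exists n, forall j, u j < \sum_i u i * jac rho (psum T n rho) i j.
  suff : \forall n \near \oo, forall j, u j < \sum_i u i * jac rho (psum T n rho) i j.
    by move=> [n _ /(_ n (leqnn n))]; exists n.
  apply: filter_forall => j.
  have : (fun n => \sum_i u i * jac rho (psum T n rho) i j) @ \oo --> r * u j.
    rewrite -uJ; apply: cvg_big => [|i _]; first exact: add_continuous.
    by apply: cvgM; [exact: cvg_cst|exact: jac_psum_cvg].
  by move/cvgr_gt; apply; rewrite ltr_pMl.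
have : \sum_j u j * gap n j < \sum_i u i * gap n i; last by rewrite ltxx.
apply: (@lt_le_trans _ _ (\sum_i u i * \sum_j jac rho (psum T n rho) i j * gap n j)).
  under [ltRHS]eq_bigr do rewrite mulr_sumr.
  rewrite exchange_big /=; apply: ltr_sum => [|j _].
    by apply/hasP; exists (Ordinal hm); rewrite ?mem_index_enum.
  under eq_bigr do rewrite mulrA.
  by rewrite -mulr_suml ltr_pM2r.
by apply: ler_sum => i _; rewrite ler_pM2l // jac_gap.
Qed.

(** Moving from [tau] by [s w] changes [G] by [s r w] to first order, leaving a margin
    [s (1 - r) w]. One half absorbs the quadratic error, the other the increase of [x]. *)
Lemma no_room_beyond r w eta : 0 < eta -> (forall i, 0 < w i) ->
  (forall i, \sum_j jac rho t i j * w j = r * w i) ->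
  (forall i, (pval (G i) (rho + eta)%R (fun j => t j + eta * w j)%R < +oo)%E) ->
  1 <= r.
Proof.
move=> eta0 w0 Jw fin; rewrite leNgt; apply/negP => r1.
have w0' j : 0 <= w j by apply: ltW.
have eta0' := ltW eta0.
have tw0 s j : 0 <= s -> 0 <= t j + s * w j by move=> s0; rewrite addr_ge0 ?mulr_ge0.
have re0 : 0 <= rho + eta by rewrite addr_ge0.
pose K i := fine (pval (G i) (rho + eta) (fun j => t j + eta * w j)).
have p0 i : (0 <= pval (G i) (rho + eta)%R (fun j => t j + eta * w j)%R)%E.
  by rewrite pval_ge0 // => j; apply: tw0.
have K0 i : 0 <= K i by rewrite fine_ge0.
have KE i : pval (G i) (rho + eta) (fun j => t j + eta * w j) = (K i)%:E.
  by rewrite fineK // ge0_fin_numE.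
have K1 i : 0 < K i + 1 by rewrite ltr_wpDl.
have room s : 0 < s -> exists2 d, 0 < d <= eta &
    forall i, d * K i <= s * ((1 - r) * w i / 2).
  move=> s0; have [|d d0 dP] := @finite_lower_bound R _ predT
      (fun i => s * ((1 - r) * w i / 2) / (K i + 1)).
    by move=> i _; rewrite !(divr_gt0, mulr_gt0) // subr_gt0.
  exists (Order.min d eta); first by rewrite lt_min d0 eta0 ge_min lexx orbT.
  move=> i; have := dP i isT; rewrite ler_pdivlMr // mulrDr mulr1 => H.
  have : Order.min d eta * K i <= d * K i by rewrite ler_wpM2r // ge_min lexx.
  lra.
(* The quadratic error carries [(s / eta) ^+ 2], so [s] is sized by [eta ^+ 2]; the error in [x]
   carries [d / eta] and must be of order [s], so [d] is sized by [s * eta]. *)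
have [s /andP[s0 se] sP] := room (eta ^+ 2) (exprn_gt0 2 eta0).
have [d /andP[d0 de] dP] := room (s * eta) (mulr_gt0 s0 eta0).
have sd0 : 0 <= d / eta by rewrite divr_ge0 // ltW.
have y0 j : 0 <= t j + s * w j by apply: tw0; apply: ltW.
have : rho + d <= rho; last by rewrite gerDl leNgt d0.
apply: (supersolution_le_radius (b := fun j => t j + s * w j)) => // [|i].
  by rewrite addr_ge0 // ltW.
apply: le_trans (pval_x_interpolate (G0 i) rho0' (ltW d0) de eta0 y0) _.
have q1 : (pval (G i) rho (fun j => t j + s * w j)%R <=
    (t i + s * (r * w i) + (s / eta) ^+ 2 * K i)%:E)%E.
  apply: le_trans (pval_quadratic (G0 i) rho0' t_ge0 w0' (ltW s0) se eta0) _.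
  rewrite extreme_solution sum_jacE //; last by move=> j; apply: dval_t_fin.
  rewrite Jw !EFinD !EFinM leeD2l // lee_wpmul2l ?lee_fin ?sqr_ge0 // -KE.
  by apply: (pval_le (G0 i) rho0') => [|j|j]; [rewrite lerDl|apply: tw0|].
have q2 : (pval (G i) (rho + eta)%R (fun j => t j + s * w j)%R <= (K i)%:E)%E.
  by rewrite -KE; apply: pval_le => // j; rewrite lerD2l ler_wpM2r.
apply: le_trans (leeD q1 (lee_wpmul2l (_ : 0 <= (d / eta)%:E)%E q2)) _.
  by rewrite lee_fin.
rewrite -EFinM -EFinD lee_fin.
have e1 : (s / eta) ^+ 2 * K i <= s * ((1 - r) * w i / 2).
  rewrite expr_div_n mulrAC ler_pdivrMr ?exprn_gt0 // expr2 -!mulrA ler_pM2l //.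
  have := sP i; lra.
have e2 : d / eta * K i <= s * ((1 - r) * w i / 2).
  rewrite mulrAC ler_pdivrMr //; have := dP i; lra.
lra.
Qed.

Lemma eigenpoint_is_extreme p : eigenpoint G p ->
  p.1 = rho /\ forall j, p.2 0 j = t j.
Proof.
move=> [[pp bG Jfin _] [_ e1]].
have [r [u [? [lr u0 uJ _ _]]]] := jacobian_perron pp Jfin.
have r1 : r = 1 by apply/eqP; rewrite eq_le e1.2 ?lr.2 ?lr.1 ?e1.1.
have {}uJ j : \sum_i u i * jac p.1 (p.2 0) i j = u j by rewrite uJ r1 mul1r.
have fin := jacobian_dval_fin Jfin; case: pp => a0 b0.
have bE i : pval (G i) p.1 (p.2 0) = (p.2 0 i)%:E := bG i.
move: a0 b0 fin bE uJ; generalize p.1 (p.2 0) => a b a0 b0 fin bE uJ.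
have a0' := ltW a0; have b0' j : 0 <= b j by apply: ltW.
have pb n j : psum T n a j <= b j.
  by apply: (psum_le_super G0 Gx hT) => // k; rewrite bE.
have ar : a <= rho by apply: (@radius_ge _ (Ordinal hm)) => // n; apply: pb.
pose s j := limn (fun n => psum T n a j).
have sP j : (fun n => psum T n a j) @ \oo --> s j.
  apply: nondecreasing_is_cvgn; first by move=> k l; apply: (psum_nondecreasing hT j a0').
  by exists (b j) => _ [n _ <-].
have sE i : pval (G i) a s = (s i)%:E := solution_at G0 Gx hT a0' sP i.
have s0 j : 0 <= s j.
  by apply: (cvgr_to_ge (sP j)); apply: nearW => n; apply: (psum_ge0 hT).
have sb j : s j <= b j by apply: (cvgr_to_le (sP j)); apply: nearW.
pose w j := b j - s j; have w0 j : 0 <= w j by rewrite subr_ge0.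
have swb : (fun j => s j + w j) = b by apply/funext => j; rewrite addrC subrK.
have wJ : forall i, w i = \sum_j jac a b i j * w j.
  (* Derivatives are taken at the upper end [b], where they are finite and [u] is fixed. *)
  apply: left_fixed_rigid u0 uJ _ => i.
  have := pval_cotangent (G0 i) a0' s0 w0.
  by rewrite swb bE sE sum_jacE // -EFinD lee_fin /w lerBlDl.
have bs j : s j = b j.
  (* One positive coordinate of [w = J w] makes all positive by irreducibility; the curvature of a
     nonlinear term then breaks the equality. *)
  apply/eqP; rewrite eq_le sb leNgt -subr_gt0; apply/negP => wj.
  have [d d0 dP] := @finite_lower_bound R _
    (fun ij : 'I_m * 'I_m => 0 < jac a b ij.1 ij.2) (fun ij => jac a b ij.1 ij.2) (fun _ h => h).
  have [c c0 cP] := harnack d0 (fun i j => jac_irreducible i j a0 b0 fin).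
  have wp i : 0 < w i.
    apply: lt_le_trans (cP w w0 _ i j) => [|k l kl]; first exact: mulr_gt0.
    apply: le_trans (_ : jac a b k l * w l <= _).
      by rewrite ler_wpM2r // (dP (k, l)).
    rewrite [leRHS]wJ (bigD1 l) //= lerDl sumr_ge0 // => l' _.
    by rewrite mulr_ge0 ?jac_ge0.
  have [i [q [Gq q2]]] := nonlinear_term.
  have [e e0] := pval_cotangent_gap (G0 i) a0 s0 wp Gq q2.
  rewrite swb bE sE sum_jacE // -!EFinD lee_fin -wJ /w.
  lra.
have {}sP j : (fun n => psum T n a j) @ \oo --> b j.
  by rewrite -bs.
have [ra|] := eqVneq a rho.
  split=> // j; rewrite ra in sP.
  exact: (cvg_unique _ (sP j) (psum_rho j)).
move=> ar'; have {ar ar'} ar : a < rho by rewrite lt_neqAle ar'.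
pose v j := t j - b j.
have bt j : b j <= t j.
  apply: (cvgr_to_le (sP j)); apply: nearW => n; apply: le_trans (psum_le_t n j).
  rewrite !psumE; apply: ler_sum => l _; rewrite ler_wpM2l //; first by case: hT.
  by rewrite lerXn2r ?nnegrE // ltW.
have v0 j : 0 <= v j by rewrite subr_ge0.
have bv : (fun j => b j + v j) = t by apply/funext => j; rewrite addrC subrK.
(* Passing from [a] to [rho] gains a positive amount from a pure [x] term, which makes the tangent
   inequality from [b] to [tau] strict. *)
have vJ i : \sum_j jac a b i j * v j < v i.
  have [q [Gq q1 q2]] := x_term i.
  have [e e0] := pval_x_gap (G0 i) a0' ar t_ge0 Gq q1 q2.
  rewrite extreme_solution => H1.
  have := pval_tangent (G0 i) a0' b0' v0; rewrite bv bE sum_jacE // => H2.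
  have := le_trans (leeD2r _ H2) H1; rewrite -!EFinD lee_fin /v; lra.
have E i : \sum_j jac a b i j * - v j = - \sum_j jac a b i j * v j.
  by rewrite -sumrN; apply: eq_bigr => j _; rewrite mulrN.
(* Applied to [-v], rigidity turns [J v <= v] into an equality, against its strictness. *)
have H := left_fixed_rigid (w := fun j => - v j) u0 uJ.
have {}H : - v (Ordinal hm) = \sum_j jac a b (Ordinal hm) j * - v j.
  by apply: H => i; rewrite E lerN2 ltW.
by have := vJ (Ordinal hm); rewrite -(oppr_inj (etrans H (E _))) ltxx.
Qed.

End Extreme.
End WellConditioned.

Theorem theorem21 (R : realType) (m : nat) (hm : (0 < m)%N) (G : pwsys R m)
    (rho : R) (tau : 'rV[R]_m)
    (hG : well_conditioned G) (hext : extreme_point G (rho, tau)) :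
  [/\ (* (a) *) pos_domain G (rho, tau),
      (* (b) *) interior (pos_domain G) (rho, tau) -> eigenpoint G (rho, tau),
      (* (c) *) (forall p q : point R m,
                   eigenpoint G p -> eigenpoint G q -> p = q),
      (* (d) *) (forall p : point R m, eigenpoint G p -> p = (rho, tau)) &
      (* (e) *) ((~ exists p : point R m, eigenpoint G p) ->
                 (closure (pos_domain G) `\` interior (pos_domain G)) (rho, tau)
                 /\ (exists2 l : R, Lambda_is G (rho, tau) l & l < 1))].
Proof.
case: hext => T hT /all_and2[Trad Trho] /=.
have sol := extreme_solution hm hG hT Trad Trho.
have pos : positive_point (rho, tau).
  by split=> [|i]; [exact: (rho_gt0 hm hG hT Trad)|exact: (t_gt0 hm hG hT Trad Trho)].
have dom : pos_domain G (rho, tau).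
  by split=> // i; rewrite pwvalE /= sol ltry.
have fin : jacobian_finite G (rho, tau).
  by move=> i j; rewrite pwvalE pval_pderiv (dval_t_fin hm hG hT Trad Trho).
have [r [u [v [lr u0 uJ v0 vJ]]]] := jacobian_perron hm hG pos fin.
have r1 : r <= 1 := left_eigenvalue_le1 hm hG hT Trad Trho u0 uJ.
have eig1 : r = 1 -> eigenpoint G (rho, tau).
  move=> rE; rewrite rE in lr uJ; split; last by split.
  split=> //; apply/eqP/det0P; exists (\row_i u i).
    by apply/matrix0Pn; exists 0, (Ordinal hm); rewrite mxE gt_eqF.
  apply/rowP => j; rewrite mulmxBr mulmx1 !mxE; apply/eqP; rewrite subr_eq0; apply/eqP.
  by rewrite -[LHS]mul1r -uJ; apply: eq_bigr => i _; rewrite mxE jacobianE.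
have eig : interior (pos_domain G) (rho, tau) -> eigenpoint G (rho, tau).
  move=> /nbhs_ballP[e /= e0 eP].
  (* The ball bounds each coordinate separately, so [eta] must satisfy [eta < e] and [eta * v i < e]
     for every [i]. *)
  have [d d0 dP] := @finite_lower_bound R 'I_m predT (fun i => e / (v i + 1))
    (fun i _ => divr_gt0 e0 (addr_gt0 (v0 i) ltr01)).
  pose eta := Order.min d e / 2.
  have md0 : 0 < Order.min d e by rewrite lt_min d0.
  have eta0 : 0 < eta by rewrite divr_gt0.
  have etae : eta < e.
    have : Order.min d e <= e by rewrite ge_min lexx orbT.
    by rewrite /eta; lra.
  have etav i : eta * v i < e.
    have := dP i isT; rewrite ler_pdivlMr ?addr_gt0 // => H.
    have : eta * v i < Order.min d e * v i by rewrite ltr_pM2r // /eta; lra.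
    have : Order.min d e * v i <= d * v i by rewrite ler_pM2r // ge_min lexx.
    by lra.
  have [_ dome] : pos_domain G (rho + eta, \row_j (tau 0 j + eta * v j)).
    apply: eP; split=> [|]; last split=> // i j; rewrite /ball /=.
      by rewrite opprD addNKr normrN gtr0_norm.
    by rewrite ord1 mxE opprD addNKr normrN gtr0_norm // mulr_gt0.
  apply/eig1/eqP; rewrite eq_le r1 /=.
  apply: (no_room_beyond hm hG hT Trad Trho eta0 v0 vJ) => i.
  have := dome i; rewrite pwvalE /=.
  rewrite (_ : (\row_j _) 0 = fun j => tau 0 j + eta * v j) //.
  by apply/funext => j; rewrite mxE.
have uniq p : eigenpoint G p -> p = (rho, tau).
  move=> /(eigenpoint_is_extreme hm hG hT Trad Trho); case: p => a b /= [-> bt].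
  by congr (_, _); apply/rowP.
split=> // [p q /uniq -> /uniq -> //|none]; split.
  split; first exact: subset_closure.
  by move/eig => H; apply: none; exists (rho, tau).
exists r => //; rewrite lt_neqAle r1 andbT; apply/eqP => /eig1 H.
by apply: none; exists (rho, tau).
Qed.
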